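(* Let $N\ge 2$ be an integer and let $0\le\lambda<\gamma\le\delta$. Then the equation $$\left(r+\sum_{m=2}^{\infty}\frac{4(\gamma-\lambda)r^{m}}{m^2[2\gamma+(\delta-\gamma)(m-1)]}\right)^2+\sum_{m=N}^{\infty}\frac{4(\gamma-\lambda)r^m}{m^2[2\gamma+(\delta-\gamma)(m-1)]}-1-4(\gamma-\lambda)\sum_{m=2}^{\infty}\frac{(-1)^{m-1}}{m^2[2\gamma+(\delta-\gamma)(m-1)]}=0$$ has a unique root $R_N(\gamma,\delta,\lambda)$ in $(0,1)$, and for every $f=h+\overline{g}\in R_H^0(\gamma,\delta,\lambda)$, $$|f(z)|^2+\sum_{m=N}^{\infty}(|a_m|+|b_m|)|z|^m\le d(f(0),\partial f(\mathbb{D}))$$ for $|z|=r\le R_N(\gamma,\delta,\lambda)$. The radius $R_N(\gamma,\delta,\lambda)$ is the best possible.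
   Context: $\mathbb{D}$ is the open unit disk in $\mathbb{C}$. $\mathcal{H}_0$ is the set of complex-valued harmonic functions $f=h+\overline{g}$ on $\mathbb{D}$ with $h,g$ analytic, $h(0)=h'(0)-1=0$, $g(0)=g'(0)=0$; write $h(z)=z+\sum_{m=2}^\infty a_mz^m$, $g(z)=\sum_{m=2}^\infty b_mz^m$. For $0\le\lambda<\gamma\le\delta$, $R_H^0(\gamma,\delta,\lambda)$ is the class of all $f=h+\overline{g}\in\mathcal{H}_0$ satisfying, for all $z\in\mathbb{D}$, $$\mathrm{Re}\left(\gamma h'(z)+\delta zh''(z)+\tfrac{\delta-\gamma}{2}z^2h'''(z)-\lambda\right)>\left|\gamma g'(z)+\delta zg''(z)+\tfrac{\delta-\gamma}{2}z^2g'''(z)\right|.$$ $d(f(0),\partial f(\mathbb{D}))$ is the Euclidean distance from $f(0)$ to the boundary of $f(\mathbb{D})$. A radius being the best possible means that it cannot be replaced by any larger number in such a way that the inequality still holds for all functions in the class. *)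

(* Defs.v *)
From Stdlib Require Export Reals.
From Coquelicot Require Export Coquelicot.

Open Scope R_scope.

Definition unit_disk (z : C) : Prop := Cmod z < 1.

Definition Series_from (N : nat) (u : nat -> R) : R :=
  Series (fun k => u (N + k)%nat).

Definition analytic_on_disk (h : C -> C) : Prop :=
  forall z, unit_disk z -> ex_derive (K := C_AbsRing) (V := C_NormedModule) h z.

Definition harmonic_map (h g : C -> C) (z : C) : C := (h z + Cconj (g z))%C.

(** A harmonic map is represented by the pair [(h, g)]; the normalisation
    [g 0 = 0] makes the decomposition [f = h + conj g] unique on the disk. *)
Definition in_H0 (h g : C -> C) : Prop :=
  analytic_on_disk h /\ analytic_on_disk g /\
  h 0%C = 0%C /\ C_derive h 0%C = 1%C /\
  g 0%C = 0%C /\ C_derive g 0%C = 0%C.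

Definition class_op (gamma delta : R) (h : C -> C) (z : C) : C :=
  (gamma * C_derive h z
   + delta * z * C_derive (C_derive h) z
   + ((delta - gamma) / 2)%R * z ^ 2 * C_derive (C_derive (C_derive h)) z)%C.

Definition in_RH0 (gamma delta lambda : R) (h g : C -> C) : Prop :=
  in_H0 h g /\
  forall z, unit_disk z ->
    Re (class_op gamma delta h z - lambda)%C > Cmod (class_op gamma delta g z).

(** [h z = c1 z + sum_(m >= 2) a_m z^m] on the disk; [a 0] and [a 1] are
    irrelevant. *)
Definition has_expansion (c1 : C) (a : nat -> C) (h : C -> C) : Prop :=
  forall z, unit_disk z ->
    is_series (K := C_AbsRing) (V := C_NormedModule)
      (fun k => a (2 + k)%nat * z ^ (2 + k))%C (h z - c1 * z)%C.

Definition image_of_disk (f : C -> C) (w : C) : Prop :=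
  exists z, unit_disk z /\ f z = w.

Definition boundary (S : C -> Prop) (w : C) : Prop :=
  forall eps : posreal,
    (exists u, S u /\ Cmod (u - w)%C < eps) /\
    (exists v, ~ S v /\ Cmod (v - w)%C < eps).

Definition dist_to_set (p : C) (S : C -> Prop) : Rbar :=
  Glb_Rbar (fun d => exists w, S w /\ d = Cmod (w - p)%C).

Definition denom (gamma delta : R) (m : nat) : R :=
  INR m ^ 2 * (2 * gamma + (delta - gamma) * (INR m - 1)).

Definition bohr_lhs (N : nat) (gamma delta lambda r : R) : R :=
  (r + Series_from 2
         (fun m => 4 * (gamma - lambda) * r ^ m / denom gamma delta m)) ^ 2
  + Series_from N
      (fun m => 4 * (gamma - lambda) * r ^ m / denom gamma delta m)
  - 1
  - 4 * (gamma - lambda)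
    * Series_from 2 (fun m => (-1) ^ (m - 1) / denom gamma delta m).

(** [a] and [b] are uniquely determined from index 2 on, by Taylor's theorem. *)
Definition bohr_inequality_upto
    (N : nat) (gamma delta lambda rho : R) : Prop :=
  forall (h g : C -> C) (a b : nat -> C),
    in_RH0 gamma delta lambda h g ->
    has_expansion 1%C a h ->
    has_expansion 0%C b g ->
    forall z : C, unit_disk z -> Cmod z <= rho ->
      Rbar_le
        (Cmod (harmonic_map h g z) ^ 2
         + Series_from N (fun m => (Cmod (a m) + Cmod (b m)) * Cmod z ^ m))
        (dist_to_set (harmonic_map h g 0%C)
                     (boundary (image_of_disk (harmonic_map h g)))).

(* Main.v *)
Require Import Defs.
From Stdlib Require Import Lra Lia.

(** Write [kappa = gamma - lambda], [c m = 4 kappa / denom gamma delta m], and let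
    [Phi r] be the sum of [r] and of the [(-1)^(m-1) c_m r^m] over [m >= 2].
    The radius equation reads
    [(r + sum_(m >= 2) c_m r^m)^2 + sum_(m >= N) c_m r^m = Phi 1], so the theorem
    says that [c_m] bounds the coefficients and that [Phi 1] bounds the distance
    to the boundary, both sharply.

    For [u] of modulus 1 the class condition makes the real part of
    [P_u = class_op h + u class_op g - lambda] positive on the disk, with
    [P_u 0 = kappa]. The operator [class_op] multiplies the coefficient of [z^m]
    by [denom m / 2], so statements about [h + u g] are statements about
    functions of positive real part. Caratheodory's bound, with [u] chosen to
    align the phases of [a_m] and [b_m], gives [|a_m| + |b_m| <= c_m]
    ([class_coeff_bound]). Harnack's bound gives
    [Re P_u >= kappa (1 - r) / (1 + r)]. Both come from one pairing lemma,
    [positive_real_part_pairing], which plays the part of the Herglotz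
    representation and is proved with averages over roots of unity.

    Since [denom (n + 1) / 2 = gamma (1 + n)^2 (1 + k n)] with [k >= 0], the passage
    from [P_u + lambda] to [(h + u g) / z] is a composition of three operators that
    divide the [n]-th coefficient by [1 + k n]. Along a radius such an operator
    is an average, hence preserves nonnegativity ([averaging_nonneg]). Applied
    to Harnack's bound this yields [|f z| >= Phi |z|] ([class_growth]), and with
    one average fewer a uniform lower bound for [Re h' - |g'|]
    ([class_jacobian]). The latter makes [f] open with constants uniform on
    smaller disks, by Newton's iteration ([harmonic_uniformly_open]). A boundary
    point of the image is therefore not approached from a smaller disk, and its
    modulus is at least [Phi 1] ([class_dist_ge]).

    The left-hand side of the radius equation increases strictly, is [- Phi 1]
    at [0], and is positive at [(1 + Phi 1) / 2]; here [0 < Phi 1 < 1]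
    because the series is alternating. For sharpness take [g = 0] and
    [h z = z + sum_(m >= 2) c_m z^m]. All upper estimates are equalities at
    positive [z], and [- Phi 1] is a boundary point of the image: it is the limit
    of [h (- t)] as [t] tends to 1, and it is not a value of [h], because [h]
    expands distances ([extremal_boundary]). *)

(** * Series of real and complex numbers *)

(** The algebraic structure on [C] comes from several towers whose carriers are
   only convertible to [C]; this normalises such an equation before [ring]. *)
Ltac C_ring :=
  unfold plus, opp, scal, minus; simpl; unfold mult; simpl;
  match goal with |- @eq _ ?a ?b => change (@eq C a b) end; ring.

Ltac R_ring :=
  unfold plus, opp, scal, minus; simpl; unfold mult; simpl; unfold Re, Im; simpl;
  match goal with |- @eq _ ?a ?b => change (@eq R a b) end; ring.

Lemma ex_series_mult_l (c : R) (a : nat -> R) :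
  ex_series a -> ex_series (fun n => c * a n).
Proof. exact (ex_series_scal_l (K := R_AbsRing) c a). Qed.

Lemma is_series_mult_l (c : R) (a : nat -> R) (l : R) :
  is_series a l -> is_series (fun n => c * a n) (c * l).
Proof. exact (is_series_scal_l (K := R_AbsRing) c a l). Qed.

Lemma Cmod_normC (x : C) : Cmod x = @norm C_AbsRing C_NormedModule x.
Proof. reflexivity. Qed.

Lemma is_series_shift_C (u : nat -> C) (l : C) :
  is_series (K := C_AbsRing) (V := C_NormedModule) u l ->
  is_series (K := C_AbsRing) (V := C_NormedModule) (fun n => u (S n)) (l - u 0%nat)%C.
Proof.
  intros H. apply (is_series_incr_1 (K := C_AbsRing) (V := C_NormedModule) u).
  change (is_series (K := C_AbsRing) (V := C_NormedModule) u (l - u 0%nat + u 0%nat)%C).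
  now replace (l - u 0%nat + u 0%nat)%C with l by ring.
Qed.

Lemma is_series_unshift_C (u : nat -> C) (l : C) :
  is_series (K := C_AbsRing) (V := C_NormedModule) (fun n => u (S n)) l ->
  is_series (K := C_AbsRing) (V := C_NormedModule) u (u 0%nat + l)%C.
Proof.
  intros H. apply (is_series_decr_1 (K := C_AbsRing) (V := C_NormedModule) u).
  change (is_series (K := C_AbsRing) (V := C_NormedModule) (fun n => u (S n))
            (u 0%nat + l - u 0%nat)%C).
  now replace (u 0%nat + l - u 0%nat)%C with l by ring.
Qed.

Lemma is_series_shift (u : nat -> R) (l : R) :
  is_series u l -> is_series (fun n => u (S n)) (l - u 0%nat).
Proof.
  intros H. apply (is_series_incr_1 (K := R_AbsRing) (V := R_NormedModule) u).
  change (is_series u (l - u 0%nat + u 0%nat)).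
  now replace (l - u 0%nat + u 0%nat) with l by ring.
Qed.

Lemma is_series_unshift (u : nat -> R) (l : R) :
  is_series (fun n => u (S n)) l -> is_series u (u 0%nat + l).
Proof.
  intros H. apply (is_series_decr_1 (K := R_AbsRing) (V := R_NormedModule) u).
  change (is_series (fun n => u (S n)) (u 0%nat + l - u 0%nat)).
  now replace (u 0%nat + l - u 0%nat) with l by ring.
Qed.

Lemma is_series_scal_C (c : C) (u : nat -> C) (l : C) :
  is_series (K := C_AbsRing) (V := C_NormedModule) u l ->
  is_series (K := C_AbsRing) (V := C_NormedModule) (fun n => c * u n)%C (c * l)%C.
Proof. exact (is_series_scal (K := C_AbsRing) (V := C_NormedModule) c u l). Qed.

Lemma is_series_eq (u v : nat -> R) (l l' : R) :
  is_series u l -> (forall n, u n = v n) -> l = l' -> is_series v l'.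
Proof. intros H E <-. exact (is_series_ext _ _ _ E H). Qed.

Lemma is_series_Re (u : nat -> C) (l : C) :
  is_series (K := C_AbsRing) (V := C_NormedModule) u l ->
  is_series (fun n => Re (u n)) (Re l).
Proof.
  intros H.
  assert (E : forall n, sum_n (fun k => Re (u k)) n
                        = Re (sum_n (G := C_NormedModule) u n)).
  { induction n as [|n IH].
    - now rewrite !sum_O.
    - rewrite !sum_Sn, IH. reflexivity. }
  apply (proj2 (filterlim_locally _ _)). intros eps.
  generalize (proj1 (filterlim_locally _ _) H eps).
  apply filter_imp. intros n Hn. rewrite E. exact (proj1 Hn).
Qed.

Lemma is_series_ReIm (u : nat -> C) (l : C) :
  is_series (fun n => Re (u n)) (Re l) ->
  is_series (fun n => Im (u n)) (Im l) ->
  is_series (K := C_AbsRing) (V := C_NormedModule) u l.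
Proof.
  intros H1 H2.
  assert (E : forall n, sum_n (G := C_NormedModule) u n
     = (sum_n (fun k => Re (u k)) n, sum_n (fun k => Im (u k)) n)).
  { induction n as [|n IH].
    - rewrite !sum_O. now destruct (u 0%nat).
    - rewrite !sum_Sn, IH. reflexivity. }
  apply (proj2 (filterlim_locally _ _)). intros eps.
  generalize (proj1 (filterlim_locally _ _) H1 eps).
  generalize (proj1 (filterlim_locally _ _) H2 eps).
  intros A B. generalize (filter_and _ _ A B).
  apply filter_imp. intros n [Hn Hm]. rewrite E. split; [exact Hm|exact Hn].
Qed.

Lemma Cmod_sum_n_le (u : nat -> C) (b : nat -> R) (n : nat) :
  (forall k, Cmod (u k) <= b k) ->
  Cmod (sum_n (G := C_NormedModule) u n) <= sum_n b n.
Proof.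
  intros H. induction n as [|n IH].
  - rewrite !sum_O. apply H.
  - rewrite !sum_Sn. eapply Rle_trans; [apply Cmod_triangle|].
    now apply Rplus_le_compat.
Qed.

Lemma Cmod_is_series_le (u : nat -> C) (l : C) (b : nat -> R) (B : R) :
  is_series (K := C_AbsRing) (V := C_NormedModule) u l ->
  (forall k, Cmod (u k) <= b k) -> is_series b B -> Cmod l <= B.
Proof.
  intros Hu Hb HB.
  apply (filterlim_le (F := eventually)
    (fun n => Cmod (sum_n (G := C_NormedModule) u n)) (sum_n b)
    (Finite (Cmod l)) (Finite B)).
  - apply filter_forall. intros n. now apply Cmod_sum_n_le.
  - apply (filterlim_comp _ _ _ (sum_n (G := C_NormedModule) u)
             (@norm C_AbsRing C_NormedModule) eventually _ _ Hu).
    exact (filterlim_norm (K := C_AbsRing) (V := C_NormedModule) l).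
  - exact HB.
Qed.

Lemma ex_series_Cmod (u : nat -> C) (b : nat -> R) :
  (forall k, Cmod (u k) <= b k) -> ex_series b ->
  ex_series (K := C_AbsRing) (V := C_NormedModule) u.
Proof.
  intros H Hb.
  apply (ex_series_le (K := C_AbsRing) (V := C_CompleteNormedModule) u b); auto.
Qed.

(** Dominated convergence for series, along any filter. It serves three limits:
    averages over more and more roots of unity, the radius tending to 1, and
    continuity of the majorant inside the disk. *)
Lemma tannery {T : Type} (F : (T -> Prop) -> Prop) {FF : ProperFilter F}
    (f : T -> nat -> R) (l b : nat -> R) :
  (forall n, filterlim (fun x => f x n) F (locally (l n))) ->
  F (fun x => forall n, Rabs (f x n) <= b n) -> ex_series b ->
  filterlim (fun x => Series (f x)) F (locally (Series l)).
Proof.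
  intros Hl Hb [B HB].
  assert (Hlb : forall n, Rabs (l n) <= b n).
  { intros n. apply Rnot_lt_le. intros C.
    assert (P : 0 < Rabs (l n) - b n) by lra.
    generalize (proj1 (filterlim_locally _ _) (Hl n) (mkposreal _ P)). intros D.
    destruct (filter_ex _ (filter_and _ _ D Hb)) as [x [Hx Hx']].
    specialize (Hx' n). change (Rabs (f x n - l n) < Rabs (l n) - b n) in Hx.
    apply Rabs_def2 in Hx.
    generalize (Rabs_triang_inv (l n) (f x n)). intros T1.
    assert (T2 : Rabs (l n - f x n) < Rabs (l n) - b n).
    { apply Rabs_def1; lra. }
    lra. }
  assert (exb : ex_series b) by (exists B; exact HB).
  assert (b0 : forall n, 0 <= b n).
  { intros n. eapply Rle_trans; [apply Rabs_pos|apply (Hlb n)]. }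
  assert (Tail : forall (u : nat -> R) N, (forall n, Rabs (u n) <= b n) ->
     Rabs (Series u - sum_n u N) <= Series b - sum_n b N).
  { intros u N Hu.
    assert (exu : ex_series (fun n => Rabs (u n))).
    { apply (ex_series_le (K := R_AbsRing) (V := R_CompleteNormedModule) _ b); auto.
      intros n. unfold norm; simpl. unfold abs; simpl. rewrite Rabs_Rabsolu. auto. }
    rewrite (Series_incr_n u (S N)), (Series_incr_n b (S N)); auto with arith.
    2: now apply ex_series_Rabs.
    simpl pred. rewrite !sum_n_Reals.
    replace (_ + _ - _) with (Series (fun k => u (S N + k)%nat)) by ring.
    replace (_ + _ - _) with (Series (fun k => b (S N + k)%nat)) by ring.
    eapply Rle_trans; [apply Series_Rabs|].
    - apply (ex_series_incr_n (fun n => Rabs (u n)) (S N)), exu.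
    - apply Series_le.
      + intros n; split; [apply Rabs_pos|apply Hu].
      + apply (ex_series_incr_n b (S N)), exb. }
  apply (proj2 (filterlim_locally _ _)). intros eps.
  assert (e3 : 0 < eps / 3) by (destruct eps; simpl; lra).
  generalize (proj1 (filterlim_locally _ _) HB (mkposreal _ e3)).
  intros [N HN]. specialize (HN N (le_n N)).
  assert (HN' : Series b - sum_n b N < eps / 3).
  { rewrite (is_series_unique _ _ HB).
    change (Rabs (sum_n b N - B) < eps / 3) in HN.
    rewrite Rabs_minus_sym in HN. eapply Rle_lt_trans; [apply Rle_abs|exact HN]. }
  assert (Hs : filterlim (fun x => sum_n (f x) N) F (locally (sum_n l N))).
  { clear -Hl FF. induction N as [|N IH].
    - rewrite sum_O. eapply filterlim_ext; [|apply (Hl 0%nat)].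
      intros x. now rewrite sum_O.
    - rewrite sum_Sn.
      apply (filterlim_ext (fun x => plus (sum_n (f x) N) (f x (S N)))).
      + intros x. now rewrite sum_Sn.
      + eapply filterlim_comp_2; [exact IH|apply Hl|].
        apply (filterlim_plus (V := R_NormedModule)). }
  generalize (proj1 (filterlim_locally _ _) Hs (mkposreal _ e3)). intros Hs'.
  generalize (filter_and _ _ Hb Hs'). apply filter_imp. intros x [Hx Hsx].
  generalize (Tail _ N Hx) (Tail _ N Hlb). intros T1 T2.
  change (Rabs (sum_n (f x) N - sum_n l N) < eps / 3) in Hsx.
  apply Rabs_def2 in Hsx.
  assert (T3 := conj T1 T2). destruct T3 as [T3 T4].
  apply Rabs_le_between in T3. apply Rabs_le_between in T4.
  change (Rabs (Series (f x) - Series l) < eps). apply Rabs_def1; lra.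
Qed.

(** * Complex power series on the unit disk *)

Definition power_series_on_disk (a : nat -> C) (h : C -> C) : Prop :=
  forall z, unit_disk z ->
    is_series (K := C_AbsRing) (V := C_NormedModule)
      (fun n => a n * z ^ n)%C (h z).

Lemma CV_radius_ge_1 (a : nat -> R) :
  (forall r, 0 <= r < 1 -> exists M, forall n, Rabs (a n * r ^ n) <= M) ->
  Rbar_le 1 (CV_radius a).
Proof.
  intros H. destruct (CV_radius_bounded a) as [Hub _].
  generalize (CV_radius_ge_0 a). unfold is_ub_Rbar in Hub. intros H0.
  destruct (CV_radius a) as [c| |]; simpl in *; auto.
  apply Rnot_lt_le. intros C.
  specialize (Hub ((c + 1) / 2)). simpl in Hub.
  assert ((c + 1) / 2 <= c); [|lra].
  apply Hub. apply H. lra.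
Qed.

Lemma CV_radius_power_series (a : nat -> C) (h : C -> C) :
  power_series_on_disk a h -> Rbar_le 1 (CV_radius (fun n => Cmod (a n))).
Proof.
  intros H. apply CV_radius_ge_1. intros r Hr.
  assert (Hd : unit_disk (RtoC r)).
  { unfold unit_disk. rewrite Cmod_R, Rabs_pos_eq; lra. }
  specialize (H _ Hd).
  destruct (filterlim_bounded (K := C_AbsRing) (V := C_NormedModule) _
              (ex_intro _ _ H)) as [M HM].
  exists (M + M). intros n.
  replace (Rabs (Cmod (a n) * r ^ n)) with (Cmod (a n * r ^ n)%C).
  2:{ rewrite Cmod_mult, <- RtoC_pow, Cmod_R, Rabs_mult.
      now rewrite (Rabs_pos_eq (Cmod _)) by apply Cmod_ge_0. }
  assert (M0 : 0 <= M).
  { eapply Rle_trans; [|apply (HM 0%nat)]. rewrite <- Cmod_normC. apply Cmod_ge_0. }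
  destruct n as [|n].
  - generalize (HM 0%nat). rewrite sum_O, <- Cmod_normC. lra.
  - replace (a (S n) * r ^ S n)%C with
      (sum_n (G := C_NormedModule) (fun k => (a k * r ^ k)%C) (S n)
       - sum_n (G := C_NormedModule) (fun k => (a k * r ^ k)%C) n)%C.
    + unfold Cminus. eapply Rle_trans; [apply Cmod_triangle|].
      rewrite Cmod_opp, !Cmod_normC. apply Rplus_le_compat; apply HM.
    + rewrite sum_Sn. C_ring.
Qed.

Lemma ex_series_inside (a : nat -> R) (r : R) :
  Rbar_le 1 (CV_radius a) -> Rabs r < 1 ->
  ex_series (fun n => Rabs (a n * r ^ n)).
Proof.
  intros H Hr. apply CV_disk_inside. eapply Rbar_lt_le_trans; [|exact H]. exact Hr.
Qed.

Lemma ex_series_Cmod_inside (a : nat -> C) (r : R) :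
  Rbar_le 1 (CV_radius (fun n => Cmod (a n))) -> 0 <= r < 1 ->
  ex_series (fun n => Cmod (a n) * r ^ n).
Proof.
  intros H Hr. eapply ex_series_ext; [|apply (ex_series_inside _ r H)].
  - intros n. apply Rabs_pos_eq. apply Rmult_le_pos; [apply Cmod_ge_0|].
    apply pow_le; lra.
  - rewrite Rabs_pos_eq; lra.
Qed.

Lemma polar_form (z : C) : exists u, Cmod u = 1 /\ z = (Cmod z * u)%C.
Proof.
  destruct (Ceq_dec z 0%C) as [->|E].
  - exists 1%C. rewrite Cmod_1, Cmod_0. split; [reflexivity|ring].
  - assert (M0 := proj1 (Cmod_gt_0 _) E).
    assert (Mn : RtoC (Cmod z) <> 0%C) by (intros H; apply RtoC_inj in H; lra).
    exists (z / Cmod z)%C. split; [|field; exact Mn].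
    rewrite Cmod_div, Cmod_R, Rabs_pos_eq by (auto; lra). field. lra.
Qed.

Lemma Cconj_mult_unit (u : C) : Cmod u = 1 -> (u * Cconj u)%C = RtoC 1.
Proof. intros H. rewrite <- Cmod2_conj, H, pow1. reflexivity. Qed.

(** This provides the sum of the derived series and the extremal map. *)
Lemma power_series_exists (a : nat -> C) :
  Rbar_le 1 (CV_radius (fun n => Cmod (a n))) ->
  exists h, power_series_on_disk a h.
Proof.
  intros H.
  exists (fun z => (Series (fun n => Re (a n * z ^ n)%C),
                    Series (fun n => Im (a n * z ^ n)%C))).
  intros z Hz.
  assert (E : ex_series (K := C_AbsRing) (V := C_NormedModule)
                (fun n => (a n * z ^ n)%C)).
  { apply (ex_series_Cmod _ (fun n => Cmod (a n) * Cmod z ^ n)).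
    - intros n. rewrite Cmod_mult, Cmod_pow. lra.
    - apply ex_series_Cmod_inside; auto. split; [apply Cmod_ge_0|exact Hz]. }
  destruct E as [l Hl].
  assert (Hm : is_series (fun n => Im (a n * z ^ n)%C) (Im l)).
  { apply (is_series_ext (fun n => Re (scal (-Ci)%C (a n * z ^ n)%C))).
    - intros n. unfold scal, Re, Im; simpl. unfold mult; simpl. ring.
    - replace (Im l) with (Re (scal (-Ci)%C l)).
      + apply is_series_Re. now apply (is_series_scal (V := C_NormedModule)).
      + unfold scal, Re, Im; simpl. unfold mult; simpl. ring. }
  apply is_series_Re in Hl.
  rewrite (is_series_unique _ _ Hl), (is_series_unique _ _ Hm).
  now apply is_series_ReIm.
Qed.

Definition deriv_coeff (a : nat -> C) (n : nat) : C := (INR (S n) * a (S n))%C.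

Lemma CV_radius_deriv_coeff (a : nat -> C) :
  CV_radius (fun n => Cmod (deriv_coeff a n)) = CV_radius (fun n => Cmod (a n)).
Proof.
  rewrite <- (CV_radius_derive (fun n => Cmod (a n))). apply CV_radius_ext.
  intros n. unfold deriv_coeff, PS_derive.
  rewrite Cmod_mult, Cmod_R, Rabs_pos_eq; [reflexivity|apply pos_INR].
Qed.

(** This is [n (n - 1) / 2 * rho ^ (n - 2)], in a recursive form that follows the
    induction below. *)
Fixpoint taylor_majorant (rho : R) (n : nat) : R :=
  match n with
  | O => 0
  | S k => rho * taylor_majorant rho k + INR k * rho ^ pred k
  end.

Lemma pow_taylor_bound (rho : R) (z w : C) (n : nat) :
  0 <= rho -> Cmod z <= rho -> Cmod w <= rho ->
  Cmod (w ^ n - z ^ n - INR n * z ^ pred n * (w - z))%C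
  <= taylor_majorant rho n * Cmod (w - z)%C ^ 2.
Proof.
  intros H0 Hz Hw. induction n as [|n IH].
  - simpl taylor_majorant. simpl Cpow.
    replace (1 - 1 - INR 0 * 1 * (w - z))%C with (RtoC 0); [rewrite Cmod_0; lra|].
    simpl. ring.
  - replace (w ^ S n - z ^ S n - INR (S n) * z ^ pred (S n) * (w - z))%C
      with (w * (w ^ n - z ^ n - INR n * z ^ pred n * (w - z))
            + INR n * z ^ pred n * (w - z) ^ 2)%C.
    + eapply Rle_trans; [apply Cmod_triangle|].
      rewrite !Cmod_mult, Cmod_pow, Cmod_R, (Rabs_pos_eq (INR n)) by apply pos_INR.
      rewrite Cmod_pow. cbn [taylor_majorant]. rewrite Rmult_plus_distr_r.
      apply Rplus_le_compat.
      * rewrite Rmult_assoc. apply Rmult_le_compat; auto using Cmod_ge_0.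
      * apply Rmult_le_compat_r; [apply pow2_ge_0|].
        apply Rmult_le_compat_l; [apply pos_INR|].
        apply pow_incr. split; auto using Cmod_ge_0.
    + rewrite S_INR, RtoC_plus. destruct n as [|n]; simpl; ring.
Qed.

Lemma taylor_majorant_le (rho : R) (n : nat) :
  0 < rho <= 1 ->
  0 <= taylor_majorant rho n <= (INR n * INR n) * rho ^ n / rho ^ 2.
Proof.
  intros H. induction n as [|n IH].
  - simpl. lra.
  - cbn [taylor_majorant]. split.
    + apply Rplus_le_le_0_compat; apply Rmult_le_pos; try lra; try apply IH.
      apply pos_INR. apply pow_le; lra.
    + destruct IH as [_ IH].
      apply Rle_trans with (rho * (INR n * INR n * rho ^ n / rho ^ 2)
                            + INR n * rho ^ S n / rho ^ 2).
      * apply Rplus_le_compat; [apply Rmult_le_compat_l; lra|].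
        destruct n as [|n]; [simpl; lra|]. simpl pred.
        unfold Rdiv. rewrite Rmult_assoc. apply Rmult_le_compat_l; [apply pos_INR|].
        right. simpl. field. lra.
      * rewrite S_INR.
        replace (rho * (INR n * INR n * rho ^ n / rho ^ 2) + INR n * rho ^ S n / rho ^ 2)
          with ((INR n * INR n + INR n) * (rho * rho ^ n / rho ^ 2)).
        2:{ simpl. field. lra. }
        replace ((INR n + 1) * (INR n + 1) * rho ^ S n / rho ^ 2)
          with ((INR n + 1) * (INR n + 1) * (rho * rho ^ n / rho ^ 2)).
        2:{ simpl. field. lra. }
        apply Rmult_le_compat_r.
        -- apply Rdiv_le_0_compat; [|apply pow_lt; lra].
           apply Rmult_le_pos; [lra|apply pow_le; lra].
        -- generalize (pos_INR n). nra.
Qed.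

(** The remainders of the monomials are summable against the coefficients,
    because differentiating a series does not change its radius. A uniform
    quadratic remainder gives differentiability as well as the convergence of
    Newton's iteration. *)
Lemma power_series_taylor (a : nat -> C) (h h' : C -> C) (rho : R) :
  power_series_on_disk a h -> power_series_on_disk (deriv_coeff a) h' ->
  0 < rho < 1 ->
  exists K, 0 < K /\ forall z w, Cmod z <= rho -> Cmod w <= rho ->
    Cmod (h w - h z - h' z * (w - z))%C <= K * Cmod (w - z)%C ^ 2.
Proof.
  intros Ha Ha' Hr.
  set (b := fun n => Cmod (a n) * taylor_majorant rho n).
  assert (Hb : ex_series b).
  { assert (R0 : Rbar_le 1 (CV_radius (PS_derive (PS_incr_1
        (PS_derive (fun n => Cmod (a n))))))).
    { rewrite CV_radius_derive, CV_radius_incr_1, CV_radius_derive.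
      exact (CV_radius_power_series _ _ Ha). }
    assert (Hr' : Rabs rho < 1) by (rewrite Rabs_pos_eq; lra).
    generalize (ex_series_inside _ _ R0 Hr'). intros E1.
    apply (ex_series_scal_r (/ rho)) in E1.
    apply (ex_series_incr_1 b).
    apply (ex_series_le (K := R_AbsRing) (V := R_CompleteNormedModule) _
             (fun n => Rabs (PS_derive (PS_incr_1
        (PS_derive (fun n => Cmod (a n)))) n * rho ^ n) * / rho) ); [|exact E1].
    intros n. destruct (taylor_majorant_le rho (S n)) as [T0 T1]; [lra|].
    unfold b. unfold norm; simpl; unfold abs; simpl.
    change (rho * taylor_majorant rho n + INR n * rho ^ Init.Nat.pred n)
      with (taylor_majorant rho (S n)).
    rewrite Rabs_pos_eq by (apply Rmult_le_pos; [apply Cmod_ge_0|exact T0]).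
    eapply Rle_trans; [apply Rmult_le_compat_l; [apply Cmod_ge_0|exact T1]|].
    eapply Rle_trans; [|apply Rmult_le_compat_r;
       [left; apply Rinv_0_lt_compat; lra|apply Rle_abs]].
    unfold PS_derive, PS_incr_1. right. simpl pow. field. lra. }
  destruct Hb as [B HB].
  exists (Rabs B + 1). split; [generalize (Rabs_pos B); lra|].
  intros z w Hz Hw.
  assert (Dz : unit_disk z) by (unfold unit_disk; lra).
  assert (Dw : unit_disk w) by (unfold unit_disk; lra).
  assert (S1 : is_series (K := C_AbsRing) (V := C_NormedModule)
     (fun n => a n * (w ^ n - z ^ n - INR n * z ^ pred n * (w - z)))%C
     (h w - h z - h' z * (w - z))%C).
  { assert (A : is_series (K := C_AbsRing) (V := C_NormedModule)
       (fun n => a n * INR n * z ^ pred n)%C (h' z)).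
    { apply (is_series_decr_1 (K := C_AbsRing) (V := C_NormedModule)).
      replace (plus (h' z) _) with (h' z).
      2:{ C_ring. }
      eapply is_series_ext; [|apply (Ha' z Dz)].
      intros n. unfold deriv_coeff. simpl pred. C_ring. }
    apply (is_series_scal (K := C_AbsRing) (V := C_NormedModule) (-(w - z))%C) in A.
    generalize (is_series_plus _ _ _ _ (is_series_minus _ _ _ _ (Ha w Dw) (Ha z Dz)) A).
    intros S1. replace (h w - h z - h' z * (w - z))%C with
      (plus (plus (h w) (opp (h z))) (@scal C_AbsRing C_NormedModule (- (w - z))%C (h' z))).
    2:{ C_ring. }
    eapply is_series_ext; [|exact S1].
    intros n. C_ring. }
  apply Rle_trans with (B * Cmod (w - z)%C ^ 2).
  - apply (Cmod_is_series_le _ _ (fun n => b n * Cmod (w - z)%C ^ 2) _ S1).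
    + intros n. rewrite Cmod_mult. unfold b. rewrite Rmult_assoc.
      apply Rmult_le_compat_l; [apply Cmod_ge_0|].
      apply pow_taylor_bound; lra.
    + exact (is_series_scal_r _ _ _ HB).
  - apply Rmult_le_compat_r; [apply pow2_ge_0|]. generalize (Rle_abs B). lra.
Qed.

Lemma Cmod_minus_sym (z w : C) : Cmod (z - w)%C = Cmod (w - z)%C.
Proof. rewrite <- Cmod_opp. f_equal. ring. Qed.

Lemma Cmod_le_of_minus (z w : C) : Cmod w <= Cmod z + Cmod (w - z)%C.
Proof.
  replace w with (z + (w - z))%C at 1 by ring. apply Cmod_triangle.
Qed.

Lemma locally_C_Cmod (z : C) (e : R) : 0 < e ->
  @locally (AbsRing_UniformSpace C_AbsRing) z (fun w => Cmod (w - z)%C < e).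
Proof. intros He. exists (mkposreal _ He). intros w Hw. exact Hw. Qed.

Lemma power_series_is_derive (a : nat -> C) (h h' : C -> C) (z : C) :
  power_series_on_disk a h -> power_series_on_disk (deriv_coeff a) h' ->
  unit_disk z ->
  is_derive (K := C_AbsRing) (V := C_NormedModule) h z (h' z).
Proof.
  intros Ha Ha' Hz. unfold unit_disk in Hz.
  generalize (Cmod_ge_0 z). intros Hz0.
  assert (Hr : 0 < (Cmod z + 1) / 2 < 1) by lra.
  destruct (power_series_taylor a h h' _ Ha Ha' Hr) as [K [K0 HK]].
  split; [apply is_linear_scal_l|].
  intros x Hx.
  assert (x = z).
  { symmetry. apply (is_filter_lim_locally_unique (V := AbsRing_NormedModule C_AbsRing)). exact Hx. }
  subst x. intros eps.
  assert (P1 : 0 < (1 - Cmod z) / 2) by lra.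
  assert (P2 : 0 < eps / K) by (apply Rdiv_lt_0_compat; [apply cond_pos|exact K0]).
  generalize (filter_and _ _ (locally_C_Cmod z _ P1) (locally_C_Cmod z _ P2)).
  apply filter_imp. intros w [H1 H2].
  generalize (Cmod_le_of_minus z w). intros H3.
  specialize (HK z w ltac:(lra) ltac:(lra)).
  change (Cmod (h w - h z - (w - z) * h' z)%C <= eps * Cmod (w - z)%C).
  replace (h w - h z - (w - z) * h' z)%C with (h w - h z - h' z * (w - z))%C by ring.
  eapply Rle_trans; [exact HK|].
  replace (K * Cmod (w - z)%C ^ 2) with ((K * Cmod (w - z)%C) * Cmod (w - z)%C) by ring.
  apply Rmult_le_compat_r; [apply Cmod_ge_0|].
  apply Rmult_lt_compat_l with (r := K) in H2; [|exact K0].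
  replace (K * (eps / K)) with (pos eps) in H2 by (field; lra). lra.
Qed.

(** [C_derive] is a limit along one direction only; complex differentiability
    identifies it with the sum of the derived series, so it can be iterated. *)
Lemma power_series_C_derive (a : nat -> C) (h : C -> C) :
  power_series_on_disk a h ->
  power_series_on_disk (deriv_coeff a) (C_derive h).
Proof.
  intros Ha.
  destruct (power_series_exists (deriv_coeff a)) as [h' Hh'].
  { rewrite CV_radius_deriv_coeff. exact (CV_radius_power_series _ _ Ha). }
  intros z Hz.
  rewrite (is_C_derive_unique h z (h' z)); [now apply Hh'|].
  now apply (power_series_is_derive a).
Qed.

(** * Averages over roots of unity *)

Definition cis (t : R) : C := (cos t, sin t).

Lemma cis_pow (t : R) (n : nat) : (cis t ^ n)%C = cis (INR n * t).
Proof.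
  induction n as [|n IH].
  - simpl. unfold cis. now rewrite Rmult_0_l, cos_0, sin_0.
  - change (cis t ^ S n)%C with (cis t * cis t ^ n)%C.
    rewrite IH, S_INR. unfold cis, Cmult; simpl.
    replace ((INR n + 1) * t) with (t + INR n * t) by ring.
    rewrite cos_plus, sin_plus. f_equal; ring.
Qed.

Lemma Cmod_cis (t : R) : Cmod (cis t) = 1.
Proof.
  unfold Cmod, cis; simpl. transitivity (sqrt 1); [f_equal|apply sqrt_1].
  generalize (sin2_cos2 t). unfold Rsqr. lra.
Qed.

Lemma geometric_sum_C (x : C) (n : nat) :
  ((x - 1) * sum_n (G := C_NormedModule) (fun j => x ^ j)%C n)%C = (x ^ S n - 1)%C.
Proof.
  induction n as [|n IH].
  - rewrite sum_O. simpl. ring.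
  - rewrite sum_Sn. unfold plus; simpl. simpl in IH.
    replace ((x - 1) * (sum_n (G := C_NormedModule) (fun j => x ^ j)%C n + x * x ^ n))%C
      with ((x - 1) * sum_n (G := C_NormedModule) (fun j => x ^ j)%C n
            + (x - 1) * (x * x ^ n))%C by ring.
    rewrite IH. ring.
Qed.

Definition unit_root (K j : nat) : C := cis (2 * PI * INR j / INR (S K)).

Lemma Cmod_unit_root (K j : nat) : Cmod (unit_root K j) = 1.
Proof. apply Cmod_cis. Qed.

(** The powers form a geometric progression whose ratio is a nontrivial
    [S K]-th root of unity. *)
Lemma sum_unit_root_pow (K k : nat) : (0 < k <= K)%nat ->
  sum_n (G := C_NormedModule) (fun j => unit_root K j ^ k)%C K = RtoC 0.
Proof.
  intros Hk.
  assert (PK : 0 < INR (S K)) by (apply lt_0_INR; lia).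
  set (x := cis (2 * PI * INR k / INR (S K))).
  assert (E : sum_n (G := C_NormedModule) (fun j => unit_root K j ^ k)%C K
              = sum_n (G := C_NormedModule) (fun j => x ^ j)%C K).
  { apply sum_n_ext. intros j. unfold unit_root, x. rewrite !cis_pow.
    f_equal. field. lra. }
  rewrite E.
  assert (X1 : (x ^ S K)%C = 1%C).
  { unfold x. rewrite cis_pow. unfold cis.
    replace (INR (S K) * (2 * PI * INR k / INR (S K))) with (0 + 2 * INR k * PI)
      by (field; lra).
    rewrite cos_period, sin_period, cos_0, sin_0. reflexivity. }
  assert (X2 : (x - 1)%C <> 0%C).
  { intros H. assert (H1 : cos (2 * PI * INR k / INR (S K)) - 1 = 0).
    { apply (f_equal Re) in H. exact H. }
    set (y := PI * INR k / INR (S K)).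
    replace (2 * PI * INR k / INR (S K)) with (2 * y) in H1
      by (unfold y; field; lra).
    rewrite cos_2a_sin in H1.
    assert (0 < sin y); [|nra].
    assert (PI0 := PI_RGT_0).
    assert (0 < INR k < INR (S K)).
    { split; [apply lt_0_INR; lia|apply lt_INR; lia]. }
    apply sin_gt_0; unfold y.
    - apply Rdiv_lt_0_compat; nra.
    - apply Rmult_lt_reg_r with (INR (S K)); [lra|].
      unfold Rdiv. rewrite Rmult_assoc, Rinv_l by lra. nra. }
  generalize (geometric_sum_C x K). rewrite X1. intros H.
  replace (1 - 1)%C with (RtoC 0) in H by ring.
  set (s := sum_n (G := C_NormedModule) (fun j => x ^ j)%C K) in *.
  change (@eq C s 0%C).
  replace s with (/ (x - 1) * ((x - 1) * s))%C by (field; exact X2).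
  rewrite H. ring.
Qed.

Definition circle_avg (K : nat) (phi : C -> R) : R :=
  sum_n (fun j => phi (unit_root K j)) K / INR (S K).

Lemma circle_avg_ext (K : nat) (phi psi : C -> R) :
  (forall x, Cmod x = 1 -> phi x = psi x) ->
  circle_avg K phi = circle_avg K psi.
Proof.
  intros H. unfold circle_avg. f_equal. apply sum_n_ext. intros j.
  apply H, Cmod_unit_root.
Qed.

Lemma circle_avg_plus (K : nat) (phi psi : C -> R) :
  circle_avg K (fun x => phi x + psi x) = circle_avg K phi + circle_avg K psi.
Proof.
  unfold circle_avg.
  change (fun j => phi (unit_root K j) + psi (unit_root K j))
    with (fun j => plus (phi (unit_root K j)) (psi (unit_root K j))).
  rewrite sum_n_plus. unfold plus; simpl. unfold Rdiv. ring.
Qed.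

Lemma circle_avg_scal (K : nat) (c : R) (phi : C -> R) :
  circle_avg K (fun x => c * phi x) = c * circle_avg K phi.
Proof.
  unfold circle_avg, Rdiv. rewrite <- Rmult_assoc. f_equal.
  exact (sum_n_mult_l (K := R_Ring) c (fun j => phi (unit_root K j)) K).
Qed.

Lemma circle_avg_const (K : nat) (c : R) : circle_avg K (fun _ => c) = c.
Proof.
  unfold circle_avg. rewrite sum_n_const. field. apply not_0_INR. lia.
Qed.

Lemma circle_avg_le (K : nat) (phi psi : C -> R) :
  (forall x, Cmod x = 1 -> phi x <= psi x) -> circle_avg K phi <= circle_avg K psi.
Proof.
  intros H. unfold circle_avg. apply Rmult_le_compat_r.
  - left. apply Rinv_0_lt_compat, lt_0_INR. lia.
  - rewrite !sum_n_Reals. apply sum_Rle. intros j _. apply H, Cmod_unit_root.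
Qed.

Lemma circle_avg_abs_le (K : nat) (phi : C -> R) (B : R) :
  (forall x, Cmod x = 1 -> Rabs (phi x) <= B) -> Rabs (circle_avg K phi) <= B.
Proof.
  intros H. apply Rabs_le_between. split.
  - rewrite <- (circle_avg_const K (- B)). apply circle_avg_le.
    intros x Hx. specialize (H x Hx). apply Rabs_le_between in H. lra.
  - rewrite <- (circle_avg_const K B). apply circle_avg_le.
    intros x Hx. specialize (H x Hx). apply Rabs_le_between in H. lra.
Qed.

Lemma circle_avg_series (K : nat) (phi : nat -> C -> R) (Phi : C -> R) :
  (forall x, Cmod x = 1 -> is_series (fun n => phi n x) (Phi x)) ->
  is_series (fun n => circle_avg K (phi n)) (circle_avg K Phi).
Proof.
  intros H. unfold circle_avg. apply is_series_scal_r.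
  assert (G : forall L, is_series
     (fun n => sum_n (fun j => phi n (unit_root K j)) L)
     (sum_n (fun j => Phi (unit_root K j)) L)); [|apply G].
  induction L as [|L IH].
  - rewrite sum_O. eapply is_series_ext; [|apply (H (unit_root K 0)), Cmod_unit_root].
    intros n. now rewrite sum_O.
  - rewrite sum_Sn.
    eapply is_series_ext;
      [|exact (is_series_plus _ _ _ _ IH (H (unit_root K (S L)) (Cmod_unit_root _ _)))].
    intros n. simpl. now rewrite sum_Sn.
Qed.

Lemma circle_avg_pow (K k : nat) (c : C) : (0 < k <= K)%nat ->
  circle_avg K (fun x => Re (c * x ^ k)%C) = 0.
Proof.
  intros Hk. unfold circle_avg.
  assert (E : forall L, sum_n (fun j => Re (c * unit_root K j ^ k)%C) L
     = Re (c * sum_n (G := C_NormedModule) (fun j => unit_root K j ^ k)%C L)%C).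
  { induction L as [|L IH].
    - now rewrite !sum_O.
    - rewrite !sum_Sn, IH. unfold plus; simpl. ring. }
  rewrite E, sum_unit_root_pow by exact Hk.
  rewrite Cmult_0_r. unfold Rdiv. simpl. ring.
Qed.

Lemma conj_unit_pow (x : C) (m n : nat) : Cmod x = 1 -> (m <= n)%nat ->
  (x ^ n * Cconj (x ^ m))%C = (x ^ (n - m))%C.
Proof.
  intros Hx Hm.
  replace n with (n - m + m)%nat at 1 by lia.
  rewrite Cpow_add_r, <- Cmult_assoc, <- Cmod2_conj, Cmod_pow, Hx, pow1, pow1.
  ring.
Qed.

Lemma Re_mult_split (u w : C) :
  Re u * Re w = Re (u * Cconj w)%C / 2 + Re (u * w)%C / 2.
Proof. unfold Re; simpl. field. Qed.

Definition cos_weight (m : nat) : R := match m with O => 1 | S _ => 2 end.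

(** Orthogonality of the harmonics under averages over sufficiently many roots
    of unity. The weight compensates for the mean of [cos^2] being [1/2],
    except at frequency zero. *)
Lemma circle_avg_orthogonal (K n m : nat) (a v : C) :
  (n + m <= K)%nat -> (n = 0%nat -> Im a = 0) ->
  circle_avg K (fun x => Re (a * x ^ n)%C * (cos_weight m * Re (v * x ^ m)%C))
  = if Nat.eqb n m then Re (a * Cconj v)%C else 0.
Proof.
  intros HK Ha.
  rewrite (circle_avg_ext K _ (fun x => (cos_weight m / 2) *
     (Re ((a * x ^ n) * Cconj (v * x ^ m))%C + Re ((a * v) * x ^ (n + m))%C))).
  2:{ intros x _.
      replace (a * v * x ^ (n + m))%C with ((a * x ^ n) * (v * x ^ m))%C
        by (rewrite Cpow_add_r; ring).
      rewrite Rmult_comm, Rmult_assoc, (Rmult_comm (Re (v * _)%C)), Re_mult_split.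
      field. }
  rewrite circle_avg_scal, circle_avg_plus.
  destruct (Nat.eqb_spec n m) as [->|Hnm].
  - rewrite (circle_avg_ext K _ (fun _ => Re (a * Cconj v)%C)).
    2:{ intros x Hx. f_equal. rewrite Cmult_conj.
        replace (a * x ^ m * (Cconj v * Cconj (x ^ m)))%C
          with (a * Cconj v * (x ^ m * Cconj (x ^ m)))%C by ring.
        rewrite conj_unit_pow, Nat.sub_diag by auto. simpl. ring. }
    rewrite circle_avg_const. destruct m as [|m].
    + rewrite (circle_avg_ext K _ (fun _ => Re (a * Cconj v)%C)).
      2:{ intros x Hx. specialize (Ha eq_refl). revert Ha. unfold Re, Im. simpl.
          intros ->. ring. }
      rewrite circle_avg_const. simpl. field.
    + rewrite circle_avg_pow by lia. simpl. field.
  - assert (E1 : circle_avg K (fun x => Re (a * v * x ^ (n + m))%C) = 0)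
      by (apply circle_avg_pow; lia).
    rewrite E1.
    assert (E2 : circle_avg K (fun x => Re (a * x ^ n * Cconj (v * x ^ m))%C) = 0).
    { destruct (Nat.lt_ge_cases m n) as [L|L].
      - rewrite <- (circle_avg_pow K (n - m) (a * Cconj v)%C) by lia.
        apply circle_avg_ext. intros x Hx. f_equal.
        rewrite <- (conj_unit_pow x m n), Cmult_conj by (auto; lia). ring.
      - rewrite <- (circle_avg_pow K (m - n) (v * Cconj a)%C) by lia.
        apply circle_avg_ext. intros x Hx.
        rewrite <- (conj_unit_pow x n m), <- re_conj by (auto; lia).
        f_equal. rewrite !Cmult_conj, !Cconj_conj. ring. }
    rewrite E2. field.
Qed.

(** * Functions with nonnegative real part *)

Lemma is_series_single (m : nat) (x : R) :
  is_series (fun n => if Nat.eqb n m then x else 0) x.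
Proof.
  assert (Z : is_series (fun _ : nat => 0) 0).
  { apply (is_series_ext (fun n => 0 * (/2) ^ n)); [intros; R_ring|].
    assert (H2 : Rabs (/ 2) < 1) by (rewrite Rabs_pos_eq; lra).
    generalize (is_series_mult_l 0 _ _ (is_series_geom _ H2)).
    now rewrite Rmult_0_l. }
  induction m as [|m IH].
  - apply (is_series_decr_1 (K := R_AbsRing) (V := R_NormedModule)). simpl.
    change (is_series (fun _ : nat => 0) (x + - x)). now rewrite Rplus_opp_r.
  - apply (is_series_decr_1 (K := R_AbsRing) (V := R_NormedModule)). simpl.
    change (is_series (fun n => if Nat.eqb n m then x else 0) (x + - 0)).
    now rewrite Ropp_0, Rplus_0_r.
Qed.

Lemma unit_disk_scal (rho : R) (x : C) :
  0 <= rho < 1 -> Cmod x <= 1 -> unit_disk (rho * x)%C.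
Proof.
  intros Hr Hx. unfold unit_disk. rewrite Cmod_mult, Cmod_R, Rabs_pos_eq by lra.
  generalize (Cmod_ge_0 x). nra.
Qed.

Lemma Rabs_Re_mult_pow_le (a x : C) (n : nat) : Cmod x = 1 ->
  Rabs (Re (a * x ^ n)%C) <= Cmod a.
Proof.
  intros Hx. eapply Rle_trans; [apply re_le_Cmod|].
  rewrite Cmod_mult, Cmod_pow, Hx, pow1. lra.
Qed.

Lemma cos_weight_bound (m : nat) : 0 <= cos_weight m <= 2.
Proof. destruct m; simpl; lra. Qed.

(** Testing a function of nonnegative real part against a nonnegative
    trigonometric series on the circle gives a nonnegative mean; expanding both
    series turns the mean into a pairing of the coefficients. The mean is taken
    over roots of unity whose number tends to infinity. *)
Lemma positive_real_part_pairing (q : nat -> C) (P : C -> C) (v : nat -> C) (rho : R) :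
  power_series_on_disk q P -> (forall z, unit_disk z -> 0 <= Re (P z)) ->
  Im (q 0%nat) = 0 -> ex_series (fun m => Cmod (v m)) ->
  (forall x, Cmod x = 1 ->
     0 <= Series (fun m => cos_weight m * Re (v m * x ^ m)%C)) ->
  0 <= rho < 1 ->
  0 <= Series (fun m => Re (q m * Cconj (v m))%C * rho ^ m).
Proof.
  intros HP Ppos Hq0 Hv Tpos Hr.
  assert (Hq : ex_series (fun n => Cmod (q n) * rho ^ n)).
  { apply ex_series_Cmod_inside; [|exact Hr]. exact (CV_radius_power_series _ _ HP). }
  assert (rn : forall n, 0 <= rho ^ n) by (intros; apply pow_le; lra).
  set (B := Series (fun n => Cmod (q n) * rho ^ n)).
  assert (SP : forall x, Cmod x = 1 ->
     is_series (fun n => Re ((q n * rho ^ n) * x ^ n)%C) (Re (P (rho * x)%C))).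
  { intros x Hx. apply is_series_Re.
    eapply is_series_ext; [|apply HP, unit_disk_scal; lra].
    intros n. simpl. rewrite Cpow_mult_l, Cmult_assoc. reflexivity. }
  assert (PB : forall x, Cmod x = 1 -> Rabs (Re (P (rho * x)%C)) <= B).
  { intros x Hx. eapply Rle_trans; [apply re_le_Cmod|].
    eapply Cmod_is_series_le;
      [apply HP, unit_disk_scal; lra| |apply Series_correct, Hq].
    intros n. simpl. rewrite Cmod_mult, Cmod_pow, Cmod_mult, Hx, Cmod_R.
    rewrite Rabs_pos_eq, Rmult_1_r by lra. lra. }
  assert (L1 : forall m, filterlim (fun K => circle_avg K (fun x =>
       Re (P (rho * x)%C) * (cos_weight m * Re (v m * x ^ m)%C))) eventually
       (locally (Re (q m * Cconj (v m))%C * rho ^ m))).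
  { intros m.
    replace (Re (q m * Cconj (v m))%C * rho ^ m) with
      (Series (fun n => if Nat.eqb n m then Re (q m * Cconj (v m))%C * rho ^ m else 0))
      by apply is_series_unique, is_series_single.
    apply (filterlim_ext (fun K => Series (fun n => circle_avg K (fun x =>
       Re ((q n * rho ^ n) * x ^ n)%C * (cos_weight m * Re (v m * x ^ m)%C))))).
    { intros K. apply is_series_unique. apply circle_avg_series.
      intros x Hx. apply is_series_scal_r. now apply SP. }
    apply (tannery eventually _ _
             (fun n => Cmod (q n) * rho ^ n * (2 * Cmod (v m)))).
    - intros n. apply (filterlim_ext_loc (fun _ => if Nat.eqb n m
           then Re (q m * Cconj (v m))%C * rho ^ m else 0)).
      + exists (n + m)%nat. intros K HK. rewrite circle_avg_orthogonal.
        * destruct (Nat.eqb_spec n m) as [->|]; [|reflexivity].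
          rewrite <- re_scal_r. f_equal. rewrite RtoC_pow. ring.
        * exact HK.
        * intros ->. rewrite <- RtoC_pow, im_scal_r, Hq0. ring.
      + apply filterlim_const.
    - apply filter_forall. intros K n. apply circle_avg_abs_le.
      intros x Hx. rewrite Rabs_mult. apply Rmult_le_compat; try apply Rabs_pos.
      + eapply Rle_trans; [now apply Rabs_Re_mult_pow_le|].
        rewrite Cmod_mult, <- RtoC_pow, Cmod_R, Rabs_pos_eq by auto. lra.
      + rewrite Rabs_mult. generalize (cos_weight_bound m). intros W.
        apply Rmult_le_compat; try apply Rabs_pos.
        * rewrite Rabs_pos_eq; lra.
        * now apply Rabs_Re_mult_pow_le.
    - now apply ex_series_scal_r. }
  assert (TS : forall x, Cmod x = 1 ->
     ex_series (fun m => cos_weight m * Re (v m * x ^ m)%C)).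
  { intros x Hx. apply (ex_series_le (K := R_AbsRing) (V := R_CompleteNormedModule)
      _ (fun m => 2 * Cmod (v m))); [|now apply ex_series_mult_l].
    intros m. unfold norm; simpl. unfold abs; simpl. rewrite Rabs_mult.
    generalize (cos_weight_bound m). intros W.
    apply Rmult_le_compat; try apply Rabs_pos.
    - rewrite Rabs_pos_eq; lra.
    - now apply Rabs_Re_mult_pow_le. }
  assert (L2 : filterlim (fun K => Series (fun m => circle_avg K (fun x =>
       Re (P (rho * x)%C) * (cos_weight m * Re (v m * x ^ m)%C)))) eventually
       (locally (Series (fun m => Re (q m * Cconj (v m))%C * rho ^ m)))).
  { apply (tannery eventually _ _ (fun m => B * (2 * Cmod (v m))) L1).
    - apply filter_forall. intros K m. apply circle_avg_abs_le. intros x Hx.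
      rewrite Rabs_mult. apply Rmult_le_compat; try apply Rabs_pos.
      + now apply PB.
      + rewrite Rabs_mult. generalize (cos_weight_bound m). intros W.
        apply Rmult_le_compat; try apply Rabs_pos.
        * rewrite Rabs_pos_eq; lra.
        * now apply Rabs_Re_mult_pow_le.
    - apply ex_series_mult_l.
      now apply ex_series_mult_l. }
  apply (filterlim_le (F := eventually) (fun _ => 0) _ (Finite 0) (Finite _))
    with (2 := filterlim_const 0) (3 := L2).
  apply filter_forall. intros K.
  rewrite (is_series_unique _ (circle_avg K (fun x => Re (P (rho * x)%C) *
     Series (fun m => cos_weight m * Re (v m * x ^ m)%C)))).
  - rewrite <- (circle_avg_const K 0). apply circle_avg_le. intros x Hx.
    apply Rmult_le_pos; [apply Ppos, unit_disk_scal; lra|now apply Tpos].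
  - apply circle_avg_series. intros x Hx.
    apply is_series_mult_l.
    apply Series_correct. now apply TS.
Qed.

(** Removes the dilation by [rho < 1] that keeps the circle inside the disk. *)
Lemma continuity_at_1_ge (f : R -> R) (r : R) :
  r < 1 -> continuity_pt f 1 -> (forall t, r < t < 1 -> 0 <= f t) -> 0 <= f 1.
Proof.
  intros Hr Hf H. apply Rnot_lt_le. intros C.
  destruct (Hf (- f 1)) as [d [d0 Hd]]; [lra|].
  set (s := Rmin d (1 - r) / 2).
  assert (Hs : 0 < s /\ s < d /\ s < 1 - r).
  { assert (0 < Rmin d (1 - r)) by (apply Rmin_glb_lt; lra).
    generalize (Rmin_l d (1 - r)) (Rmin_r d (1 - r)). unfold s. lra. }
  specialize (Hd (1 - s)). simpl in Hd. unfold Rdist in Hd.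
  specialize (H (1 - s) ltac:(lra)).
  assert (Rabs (f (1 - s) - f 1) < - f 1).
  { apply Hd. split; [split; [exact I|lra]|].
    rewrite Rabs_minus_sym, Rabs_pos_eq; lra. }
  generalize (Rle_abs (f (1 - s) - f 1)). lra.
Qed.

(** Caratheodory's coefficient bound: test against [1 - Re (u x ^ n)] with [u]
    the direction of the [n]-th coefficient. *)
Lemma caratheodory_bound (q : nat -> C) (P : C -> C) (n : nat) :
  power_series_on_disk q P -> (forall z, unit_disk z -> 0 <= Re (P z)) ->
  Im (q 0%nat) = 0 -> (0 < n)%nat -> Cmod (q n) <= 2 * Re (q 0%nat).
Proof.
  intros HP Ppos Hq0 Hn.
  destruct (polar_form (q n)) as [u [Hu Eu]].
  set (v := fun m => if Nat.eqb m 0 then RtoC 1 else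
                     if Nat.eqb m n then (RtoC (- / 2) * u)%C else RtoC 0).
  assert (two : forall f : nat -> R, (forall m, m <> 0%nat -> m <> n -> f m = 0) ->
     is_series f (f 0%nat + f n)).
  { intros f Hf.
    apply (is_series_ext (fun m => plus (if Nat.eqb m 0 then f 0%nat else 0)
                                        (if Nat.eqb m n then f n else 0))).
    - intros m. destruct (Nat.eqb_spec m 0) as [->|H1].
      + destruct (Nat.eqb_spec 0 n); [lia|]. unfold plus; simpl. ring.
      + destruct (Nat.eqb_spec m n) as [->|H2]; unfold plus; simpl; [ring|].
        rewrite Hf; auto. ring.
    - apply (is_series_plus (V := R_NormedModule)); apply is_series_single. }
  assert (v0 : v 0%nat = RtoC 1) by reflexivity.
  assert (vn : v n = (RtoC (- / 2) * u)%C).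
  { unfold v. rewrite Nat.eqb_refl. destruct (Nat.eqb_spec n 0); [lia|reflexivity]. }
  assert (vz : forall m, m <> 0%nat -> m <> n -> v m = RtoC 0).
  { intros m H1 H2. unfold v. destruct (Nat.eqb_spec m 0); [lia|].
    destruct (Nat.eqb_spec m n); [lia|reflexivity]. }
  assert (wn : cos_weight n = 2) by (destruct n; [lia|reflexivity]).
  assert (Key : forall t, 0 < t < 1 -> 0 <= 2 * Re (q 0%nat) - Cmod (q n) * t ^ n).
  { intros t Ht.
    assert (H := positive_real_part_pairing q P v t HP Ppos Hq0).
    assert (Hpair : is_series (fun m => Re (q m * Cconj (v m))%C * t ^ m)
                      (Re (q 0%nat) - Cmod (q n) / 2 * t ^ n)).
    { replace (Re (q 0%nat) - Cmod (q n) / 2 * t ^ n) with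
        (Re (q 0%nat * Cconj (v 0%nat))%C * t ^ 0 + Re (q n * Cconj (v n))%C * t ^ n).
      - apply (two (fun m => Re (q m * Cconj (v m))%C * t ^ m)).
        intros m H1 H2. rewrite vz by auto. unfold Re; simpl. ring.
      - rewrite v0, vn.
        replace (q n * Cconj (RtoC (- / 2) * u))%C with (RtoC (- Cmod (q n) / 2)).
        + unfold Re; simpl. field.
        + rewrite Eu at 2. rewrite Cmult_conj.
          replace (Cmod (q n) * u * (Cconj (RtoC (- / 2)) * Cconj u))%C with
            (Cmod (q n) * Cconj (RtoC (- / 2)) * (u * Cconj u))%C by ring.
          rewrite Cconj_mult_unit by exact Hu.
          unfold RtoC, Cconj, Cmult; simpl. f_equal; field. }
    rewrite (is_series_unique _ _ Hpair) in H.
    assert (0 <= Re (q 0%nat) - Cmod (q n) / 2 * t ^ n); [|lra].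
    apply H; [| |lra].
    - eexists. apply (two (fun m => Cmod (v m))). intros m H1 H2.
      cbv beta. rewrite vz, Cmod_0 by auto. reflexivity.
    - intros x Hx. rewrite (is_series_unique _ _ (two
         (fun m => cos_weight m * Re (v m * x ^ m)%C) ltac:(intros m H1 H2;
            cbv beta; rewrite vz by auto; unfold Re; simpl; ring))).
      rewrite v0, vn, wn.
      assert (Rabs (Re (RtoC (- / 2) * u * x ^ n)%C) <= / 2).
      { eapply Rle_trans; [now apply Rabs_Re_mult_pow_le|].
        rewrite Cmod_mult, Hu, Cmod_R, Rabs_left; lra. }
      apply Rabs_le_between in H0. simpl cos_weight.
      replace (Re (1 * x ^ 0)%C) with 1 by (unfold Re; simpl; ring). lra. }
  assert (H := continuity_at_1_ge (fun t => 2 * Re (q 0%nat) - Cmod (q n) * t ^ n) 0).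
  simpl in H. rewrite pow1 in H.
  assert (0 <= 2 * Re (q 0%nat) - Cmod (q n) * 1); [|lra].
  apply H; [lra| |exact Key].
  apply derivable_continuous_pt. reg.
Qed.

Lemma power_series_0 (a : nat -> C) (h : C -> C) :
  power_series_on_disk a h -> h 0%C = a 0%nat.
Proof.
  intros H.
  assert (U0 : unit_disk 0%C) by (unfold unit_disk; rewrite Cmod_0; lra).
  specialize (H _ U0).
  assert (H1 : is_series (K := C_AbsRing) (V := C_NormedModule)
      (fun n => a n * 0 ^ n)%C (a 0%nat)).
  { apply is_series_ReIm.
    - apply (is_series_ext (fun n => if Nat.eqb n 0 then Re (a 0%nat) else 0));
        [|apply is_series_single].
      intros [|n]; unfold Re; simpl; ring.
    - apply (is_series_ext (fun n => if Nat.eqb n 0 then Im (a 0%nat) else 0));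
        [|apply is_series_single].
      intros [|n]; unfold Im; simpl; ring. }
  exact (filterlim_locally_unique (K := C_AbsRing) (V := C_NormedModule) _ _ _ H H1).
Qed.

Lemma geometric_series_C (s : C) (G : C) :
  is_series (K := C_AbsRing) (V := C_NormedModule) (fun n => s ^ n)%C G ->
  ((1 - s) * G)%C = 1%C.
Proof.
  intros H.
  assert (H1 := is_series_scal (K := C_AbsRing) (V := C_NormedModule) s _ _ H).
  assert (H2 : is_series (K := C_AbsRing) (V := C_NormedModule)
     (fun n => s ^ S n)%C (G - 1)%C) by exact (is_series_shift_C _ _ H).
  assert (E := filterlim_locally_unique (K := C_AbsRing) (V := C_NormedModule)
                 _ _ _ H1 H2).
  replace ((1 - s) * G)%C with (G - scal s G)%C by C_ring.
  change (scal s G) with (s * G)%C in *. rewrite E. ring.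
Qed.

(** The Poisson kernel is minimal at the point opposite to its pole. *)
Lemma Re_inv_1_minus_ge (s G : C) : Cmod s < 1 -> ((1 - s) * G)%C = 1%C ->
  / (1 + Cmod s) <= Re G.
Proof.
  intros Hs HG.
  assert (H := Cmod2_alt s). assert (H0 := Cmod_ge_0 s).
  assert (H1 := re_le_Cmod s). apply Rabs_le_between in H1.
  destruct s as [x y], G as [g k]. unfold Re, Im in *. simpl fst in *; simpl snd in *.
  assert (E1 := f_equal fst HG). assert (E2 := f_equal snd HG). simpl in E1, E2.
  set (r := Cmod (x, y)) in *.
  assert (Eg : g * ((1 - x) ^ 2 + y ^ 2) = 1 - x).
  { replace (g * ((1 - x) ^ 2 + y ^ 2)) with
      ((1 - x) * ((1 + - x) * g - (0 + - y) * k)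
       - y * ((1 + - x) * k + (0 + - y) * g)) by ring.
    rewrite E1, E2. ring. }
  assert (D : 0 < (1 - x) ^ 2 + y ^ 2) by nra.
  replace g with ((1 - x) / ((1 - x) ^ 2 + y ^ 2)).
  2:{ apply (Rmult_eq_reg_r ((1 - x) ^ 2 + y ^ 2)); [|lra].
      rewrite Eg. field. lra. }
  apply Rmult_le_reg_r with ((1 + r) * ((1 - x) ^ 2 + y ^ 2)); [nra|].
  replace (/ (1 + r) * ((1 + r) * ((1 - x) ^ 2 + y ^ 2)))
    with ((1 - x) ^ 2 + y ^ 2) by (field; lra).
  replace ((1 - x) / ((1 - x) ^ 2 + y ^ 2) * ((1 + r) * ((1 - x) ^ 2 + y ^ 2)))
    with ((1 - x) * (1 + r)) by (field; lra).
  nra.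
Qed.

(** Harnack's inequality: test against the Poisson kernel minus its minimum on
    the circle. *)
Lemma harnack_lower (q : nat -> C) (P : C -> C) (z : C) :
  power_series_on_disk q P -> (forall z, unit_disk z -> 0 <= Re (P z)) ->
  Im (q 0%nat) = 0 -> unit_disk z ->
  Re (q 0%nat) * ((1 - Cmod z) / (1 + Cmod z)) <= Re (P z).
Proof.
  intros HP Ppos Hq0 Hz. unfold unit_disk in Hz.
  assert (z0 := Cmod_ge_0 z).
  assert (Key : forall t, Cmod z < t < 1 ->
     0 <= (t + Cmod z) * Re (P z) - (t - Cmod z) * Re (q 0%nat)).
  { intros t Ht.
    set (w := (z / t)%C).
    assert (tn : RtoC t <> 0%C) by (intros HH; apply RtoC_inj in HH; lra).
    assert (zw : z = (t * w)%C) by (unfold w; field; exact tn).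
    assert (rw : Cmod z = t * Cmod w).
    { rewrite zw at 1. rewrite Cmod_mult, Cmod_R, Rabs_pos_eq; lra. }
    set (r := Cmod w) in *.
    assert (r0 : 0 <= r) by apply Cmod_ge_0.
    assert (r1 : r < 1) by nra.
    (* The constant is [1 - (1 - r) / (1 + r)], one minus the minimum of the kernel. *)
    set (v := fun m => match m with O => RtoC (2 * r / (1 + r))
                                | S _ => (Cconj w ^ m)%C end).
    assert (geo : forall s, Cmod s < 1 -> exists G, is_series (K := C_AbsRing)
        (V := C_NormedModule) (fun n => s ^ n)%C G /\ / (1 + Cmod s) <= Re G).
    { intros s Hs.
      destruct (ex_series_Cmod (fun n => s ^ n)%C (fun n => Cmod s ^ n)) as [G HG].
      - intros n. rewrite Cmod_pow. lra.
      - apply ex_series_geom. rewrite Rabs_pos_eq; [exact Hs|apply Cmod_ge_0].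
      - exists G. split; [exact HG|]. apply Re_inv_1_minus_ge; [exact Hs|].
        now apply geometric_series_C. }
    assert (Hv : ex_series (fun m => Cmod (v m))).
    { apply (ex_series_incr_1 (K := R_AbsRing) (V := R_NormedModule)).
      apply (ex_series_ext (fun n => r ^ S n)).
      - intros n. simpl v. rewrite <- Cpow_S, Cmod_pow, Cmod_conj. reflexivity.
      - apply (ex_series_incr_1 (K := R_AbsRing) (V := R_NormedModule) (fun n => r ^ n)).
        apply ex_series_geom. rewrite Rabs_pos_eq; lra. }
    assert (H := positive_real_part_pairing q P v t HP Ppos Hq0 Hv).
    assert (Hpair : is_series (fun m => Re (q m * Cconj (v m))%C * t ^ m)
                      (Re (P z) - Re (q 0%nat) + Re (q 0%nat) * (2 * r / (1 + r)))).
    { replace (Re (P z) - Re (q 0%nat) + Re (q 0%nat) * (2 * r / (1 + r))) with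
        (Re (q 0%nat * Cconj (v 0%nat))%C * t ^ 0 + (Re (P z) - Re (q 0%nat * z ^ 0)%C))
        by (unfold Re; simpl; ring).
      apply (is_series_unshift (fun m => Re (q m * Cconj (v m))%C * t ^ m)).
      apply (is_series_ext (fun m => Re (q (S m) * z ^ S m)%C)).
      - intros m. simpl v. rewrite <- Cpow_S, Cpow_conj, Cconj_conj.
        rewrite zw, Cpow_mult_l, <- re_scal_r, RtoC_pow. f_equal. ring.
      - exact (is_series_shift _ _ (is_series_Re _ _ (HP z Hz))). }
    rewrite (is_series_unique _ _ Hpair) in H.
    assert (Fin : 0 <= Re (P z) - Re (q 0%nat) + Re (q 0%nat) * (2 * r / (1 + r))).
    { apply H; [|lra]. intros x Hx.
      assert (sx : Cmod (Cconj w * x)%C = r).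
      { rewrite Cmod_mult, Cmod_conj, Hx. fold r. ring. }
      destruct (geo (Cconj w * x)%C) as [G [HG RG]]; [lra|].
      rewrite sx in RG.
      assert (T : is_series (fun m => cos_weight m * Re (v m * x ^ m)%C)
                    (2 * (Re G - 1) + 2 * r / (1 + r))).
      { replace (2 * (Re G - 1) + 2 * r / (1 + r)) with
          (cos_weight 0 * Re (v 0%nat * x ^ 0)%C
           + 2 * (Re G - Re ((Cconj w * x) ^ 0)%C)) by (unfold Re; simpl; ring).
        apply (is_series_unshift (fun m => cos_weight m * Re (v m * x ^ m)%C)).
        apply (is_series_ext (fun m => 2 * Re ((Cconj w * x) ^ S m)%C)).
        - intros m. simpl v. rewrite <- Cpow_S, Cpow_mult_l. reflexivity.
        - apply is_series_mult_l.
          exact (is_series_shift _ _ (is_series_Re _ _ HG)). }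
      rewrite (is_series_unique _ _ T).
      replace (2 * r / (1 + r)) with (2 - 2 * / (1 + r)) by (field; lra). lra. }
    rewrite rw.
    replace ((t + t * r) * Re (P z) - (t - t * r) * Re (q 0%nat)) with
      (t * (1 + r) * (Re (P z) - Re (q 0%nat) + Re (q 0%nat) * (2 * r / (1 + r))))
      by (field; lra).
    apply Rmult_le_pos; [nra|exact Fin]. }
  assert (H := continuity_at_1_ge (fun t =>
     (t + Cmod z) * Re (P z) - (t - Cmod z) * Re (q 0%nat)) (Cmod z) Hz).
  simpl in H.
  assert (F : 0 <= (1 + Cmod z) * Re (P z) - (1 - Cmod z) * Re (q 0%nat)).
  { apply H; [|exact Key]. apply derivable_continuous_pt. reg. }
  apply Rmult_le_reg_r with (1 + Cmod z); [lra|].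
  replace (Re (q 0%nat) * ((1 - Cmod z) / (1 + Cmod z)) * (1 + Cmod z))
    with (Re (q 0%nat) * (1 - Cmod z)) by (field; lra). lra.
Qed.

(** * The averaging operators *)

Lemma term_le_Series (u : nat -> R) (m : nat) :
  (forall n, 0 <= u n) -> ex_series u -> u m <= Series u.
Proof.
  intros H0 Hu. rewrite <- (is_series_unique _ _ (is_series_single m (u m))).
  apply Series_le; [|exact Hu]. intros n. destruct (Nat.eqb_spec n m) as [->|].
  - split; [apply H0|lra].
  - split; [lra|apply H0].
Qed.

Lemma CV_radius_dominated (a b : nat -> R) :
  (forall n, Rabs (b n) <= Rabs (a n)) ->
  Rbar_le 1 (CV_radius a) -> Rbar_le 1 (CV_radius b).
Proof.
  intros H Ha. apply CV_radius_ge_1. intros r Hr.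
  assert (Hr' : Rabs r < 1) by (rewrite Rabs_pos_eq; lra).
  exists (Series (fun n => Rabs (a n * r ^ n))). intros n.
  apply Rle_trans with (Rabs (a n * r ^ n)).
  - rewrite !Rabs_mult. apply Rmult_le_compat_r; [apply Rabs_pos|apply H].
  - apply (term_le_Series (fun n => Rabs (a n * r ^ n))).
    + intros k. apply Rabs_pos.
    + now apply ex_series_inside.
Qed.

Lemma inside_CV_radius (a : nat -> R) (t : R) :
  Rbar_le 1 (CV_radius a) -> 0 <= t < 1 -> Rbar_lt (Rabs t) (CV_radius a).
Proof.
  intros H Ht. eapply Rbar_lt_le_trans; [|exact H]. simpl. rewrite Rabs_pos_eq; lra.
Qed.

Lemma avg_denom_pos (c : R) (n : nat) : 0 <= c -> 1 <= 1 + c * INR n.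
Proof. intros H. generalize (pos_INR n). nra. Qed.

Lemma averaging_radius (c : R) (a : nat -> R) :
  0 <= c -> Rbar_le 1 (CV_radius a) ->
  Rbar_le 1 (CV_radius (fun n => a n / (1 + c * INR n))).
Proof.
  intros Hc. apply CV_radius_dominated. intros n.
  assert (H := avg_denom_pos c n Hc).
  unfold Rdiv. rewrite Rabs_mult.
  assert (0 < / (1 + c * INR n)) by (apply Rinv_0_lt_compat; lra).
  assert (/ (1 + c * INR n) <= 1).
  { rewrite <- Rinv_1. apply Rinv_le_contravar; lra. }
  rewrite (Rabs_pos_eq (/ _)) by lra.
  generalize (Rabs_pos (a n)). nra.
Qed.

Lemma averaging_radius_once (c : R) (a : nat -> R) :
  0 <= c -> Rbar_le 1 (CV_radius a) ->
  Rbar_le 1 (CV_radius (fun n => a n / (1 + INR n) / (1 + c * INR n))).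
Proof.
  intros Hc Ha. apply (averaging_radius c _ Hc).
  generalize (averaging_radius 1 _ Rle_0_1 Ha).
  apply CV_radius_dominated. intros n. rewrite Rmult_1_l. lra.
Qed.

Lemma averaging_radius_twice (c : R) (a : nat -> R) :
  0 <= c -> Rbar_le 1 (CV_radius a) ->
  Rbar_le 1 (CV_radius (fun n => a n / (1 + INR n) / (1 + INR n) / (1 + c * INR n))).
Proof.
  intros Hc Ha. apply (averaging_radius_once c _ Hc).
  generalize (averaging_radius 1 _ Rle_0_1 Ha).
  apply CV_radius_dominated. intros n. rewrite Rmult_1_l. lra.
Qed.

(** Dividing the [n]-th coefficient by [1 + c n] averages the function along the
    radius, for [c > 0] with weight proportional to [s ^ (1 / c - 1)]. The
    differential equation replaces this weight: the averaged function [f] solves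
    [f + c t f' = PSeries a], so at a negative minimum the derivative would be
    positive, and [f] would be smaller just to the left. *)
Lemma averaging_nonneg (c : R) (a : nat -> R) :
  0 <= c -> Rbar_le 1 (CV_radius a) ->
  (forall t, 0 <= t < 1 -> 0 <= PSeries a t) ->
  forall t, 0 <= t < 1 -> 0 <= PSeries (fun n => a n / (1 + c * INR n)) t.
Proof.
  intros Hc Ha Hpos t0 Ht0.
  set (b := fun n => a n / (1 + c * INR n)).
  assert (Hb : Rbar_le 1 (CV_radius b)) by now apply averaging_radius.
  assert (Hb' : Rbar_le 1 (CV_radius (PS_derive b))) by now rewrite CV_radius_derive.
  assert (ODE : forall t, 0 <= t < 1 ->
     PSeries a t = PSeries b t + c * (t * PSeries (PS_derive b) t)).
  { intros t Ht.
    assert (E1 := CV_radius_inside _ _ (inside_CV_radius _ _ Hb Ht)).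
    assert (E2 := CV_radius_inside _ _ (inside_CV_radius _ _ Hb' Ht)).
    rewrite <- PSeries_incr_1, <- PSeries_scal, <- PSeries_plus; auto.
    - apply PSeries_ext. intros n. unfold PS_plus, PS_scal, PS_incr_1, PS_derive.
      assert (H := avg_denom_pos c n Hc).
      destruct n as [|n]; unfold b, plus, scal, zero; simpl; unfold mult; simpl.
      + field.
      + simpl in H. field. lra.
    - apply ex_pseries_scal; [apply Rmult_comm|now apply ex_pseries_incr_1]. }
  apply Rnot_lt_le. intros Hneg.
  assert (Cont : forall x, 0 <= x <= t0 -> continuity_pt (PSeries b) x).
  { intros x Hx. apply PSeries_continuity, inside_CV_radius; [exact Hb|lra]. }
  destruct (continuity_ab_min (PSeries b) 0 t0 ltac:(lra) Cont) as [t1 [Hmin Ht1]].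
  assert (F1 : PSeries b t1 < 0).
  { apply Rle_lt_trans with (PSeries b t0); [apply Hmin; lra|exact Hneg]. }
  assert (O1 := ODE t1 ltac:(lra)). assert (P1 := Hpos t1 ltac:(lra)).
  assert (T1 : 0 < t1).
  { destruct (Req_dec t1 0) as [E|E]; [|lra]. rewrite E in *. lra. }
  set (l := PSeries (PS_derive b) t1) in *.
  assert (Hl : 0 < l).
  { apply Rnot_le_lt. intros Hl. assert (0 <= c * t1) by nra. nra. }
  assert (D : derivable_pt_lim (PSeries b) t1 l).
  { apply is_derive_Reals, is_derive_PSeries, inside_CV_radius; [exact Hb|lra]. }
  destruct (D l Hl) as [d Hd].
  assert (dp := cond_pos d).
  set (s := Rmin d t1 / 2).
  assert (Hs : 0 < s /\ s < d /\ s < t1).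
  { assert (0 < Rmin d t1) by (apply Rmin_glb_lt; lra).
    generalize (Rmin_l d t1) (Rmin_r d t1). unfold s. lra. }
  specialize (Hd (- s) ltac:(lra)).
  rewrite Rabs_Ropp, Rabs_pos_eq in Hd by lra. specialize (Hd ltac:(lra)).
  apply Rabs_def2 in Hd. destruct Hd as [_ Hd].
  assert (Hq : 0 < (PSeries b (t1 + - s) - PSeries b t1) / - s) by lra.
  assert (Hm := Hmin (t1 + - s) ltac:(lra)).
  set (X := PSeries b (t1 + - s) - PSeries b t1) in *.
  assert (X / - s <= 0); [|lra].
  replace (X / - s) with (- (X * / s)) by (field; lra).
  assert (0 < / s) by (apply Rinv_0_lt_compat; lra).
  assert (0 <= X) by (unfold X; lra). nra.
Qed.

(** * Radial minorants for functions of positive real part *)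

(** The expansion of [(1 - t) / (1 + t)]. *)
Definition harnack_coeff (n : nat) : R :=
  match n with O => 1 | S _ => 2 * (-1) ^ n end.

Lemma harnack_coeff_bound (n : nat) : Rabs (harnack_coeff n) <= 2.
Proof.
  destruct n as [|n].
  - simpl. rewrite Rabs_pos_eq; lra.
  - change (harnack_coeff (S n)) with (2 * (-1) ^ S n). rewrite Rabs_mult, pow_1_abs, Rabs_pos_eq; lra.
Qed.

Lemma harnack_coeff_radius : Rbar_le 1 (CV_radius harnack_coeff).
Proof.
  apply CV_radius_ge_1. intros r Hr. exists 2. intros n.
  rewrite Rabs_mult. rewrite <- (Rmult_1_r 2).
  apply Rmult_le_compat; try apply Rabs_pos; [apply harnack_coeff_bound|].
  rewrite <- RPow_abs, Rabs_pos_eq by lra. rewrite <- (pow1 n). apply pow_incr. lra.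
Qed.

Lemma harnack_coeff_PSeries (t : R) : 0 <= t < 1 ->
  PSeries harnack_coeff t = (1 - t) / (1 + t).
Proof.
  intros Ht.
  assert (G : Rabs (- t) < 1) by (rewrite Rabs_Ropp, Rabs_pos_eq; lra).
  assert (S1 := is_series_mult_l 2 _ _ (is_series_shift _ _ (is_series_geom _ G))).
  apply is_series_unique.
  replace ((1 - t) / (1 + t)) with (harnack_coeff 0 * t ^ 0
     + 2 * (/ (1 - - t) - (- t) ^ 0)) by (simpl; field; lra).
  apply (is_series_unshift (fun n => harnack_coeff n * t ^ n)).
  eapply is_series_ext; [|exact S1].
  intros n. simpl harnack_coeff. replace (- t) with (-1 * t) by ring.
  rewrite Rpow_mult_distr. simpl. ring.
Qed.

Lemma is_series_radial (q : nat -> C) (P : C -> C) (x : C) (t : R) :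
  power_series_on_disk q P -> Cmod x = 1 -> 0 <= t < 1 ->
  is_series (fun n => Re (q n * x ^ n)%C * t ^ n) (Re (P (t * x)%C)).
Proof.
  intros HP Hx Ht.
  eapply is_series_ext; [|apply is_series_Re, HP, unit_disk_scal; lra].
  intros n. cbv beta. rewrite Cpow_mult_l, <- re_scal_r, RtoC_pow. f_equal. ring.
Qed.

Lemma radial_radius (q : nat -> C) (P : C -> C) (x : C) :
  power_series_on_disk q P -> Cmod x = 1 ->
  Rbar_le 1 (CV_radius (fun n => Re (q n * x ^ n)%C)).
Proof.
  intros HP Hx. apply (CV_radius_dominated (fun n => Cmod (q n))).
  - intros n. rewrite (Rabs_pos_eq (Cmod _)) by apply Cmod_ge_0.
    now apply Rabs_Re_mult_pow_le.
  - exact (CV_radius_power_series _ _ HP).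
Qed.

Lemma CV_radius_minus (a b : nat -> R) :
  Rbar_le 1 (CV_radius a) -> Rbar_le 1 (CV_radius b) ->
  Rbar_le 1 (CV_radius (fun n => a n - b n)).
Proof.
  intros Ha Hb. apply CV_radius_ge_1. intros r Hr.
  assert (Hr' : Rabs r < 1) by (rewrite Rabs_pos_eq; lra).
  assert (Ea := ex_series_inside _ _ Ha Hr'). assert (Eb := ex_series_inside _ _ Hb Hr').
  exists (Series (fun n => Rabs (a n * r ^ n)) + Series (fun n => Rabs (b n * r ^ n))).
  intros n. replace ((a n - b n) * r ^ n) with (a n * r ^ n + - (b n * r ^ n)) by ring.
  eapply Rle_trans; [apply Rabs_triang|]. rewrite Rabs_Ropp.
  apply Rplus_le_compat.
  - apply (term_le_Series (fun n => Rabs (a n * r ^ n))); auto using Rabs_pos.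
  - apply (term_le_Series (fun n => Rabs (b n * r ^ n))); auto using Rabs_pos.
Qed.

Lemma CV_radius_mult_const (k : R) (a : nat -> R) :
  Rbar_le 1 (CV_radius a) -> Rbar_le 1 (CV_radius (fun n => k * a n)).
Proof.
  intros Ha. apply CV_radius_ge_1. intros r Hr.
  assert (Hr' : Rabs r < 1) by (rewrite Rabs_pos_eq; lra).
  assert (Ea := ex_series_inside _ _ Ha Hr').
  exists (Rabs k * Series (fun n => Rabs (a n * r ^ n))).
  intros n. rewrite Rmult_assoc, Rabs_mult. apply Rmult_le_compat_l; [apply Rabs_pos|].
  apply (term_le_Series (fun n => Rabs (a n * r ^ n))); auto using Rabs_pos.
Qed.

Lemma PSeries_minus_mult (a b : nat -> R) (k t : R) :
  Rbar_le 1 (CV_radius a) -> Rbar_le 1 (CV_radius b) -> 0 <= t < 1 ->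
  PSeries (fun n => a n - k * b n) t = PSeries a t - k * PSeries b t.
Proof.
  intros Ha Hb Ht.
  assert (Hr' : Rabs t < 1) by (rewrite Rabs_pos_eq; lra).
  assert (Ea := ex_series_Rabs _ (ex_series_inside _ _ Ha Hr')).
  assert (Eb := ex_series_Rabs _ (ex_series_inside _ _ Hb Hr')).
  unfold PSeries. rewrite <- Series_scal_l, <- Series_minus; auto.
  - apply Series_ext. intros n. ring.
  - now apply ex_series_mult_l.
Qed.

(** Harnack's bound says that a difference of power series is nonnegative on
    the radius, and the averaging operators preserve this. *)
Lemma radial_minorant_twice (q : nat -> C) (P : C -> C) (x : C) (c t : R) :
  power_series_on_disk q P -> (forall z, unit_disk z -> 0 <= Re (P z)) ->
  Im (q 0%nat) = 0 -> Cmod x = 1 -> 0 <= c -> 0 <= t < 1 ->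
  Re (q 0%nat) *
    PSeries (fun n => harnack_coeff n / (1 + INR n) / (1 + INR n) / (1 + c * INR n)) t
  <= PSeries (fun n => Re (q n * x ^ n)%C / (1 + INR n) / (1 + INR n) / (1 + c * INR n)) t.
Proof.
  intros HP Ppos Hq0 Hx Hc Ht.
  set (k := Re (q 0%nat)).
  set (d := fun n => Re (q n * x ^ n)%C - k * harnack_coeff n).
  assert (R1 := radial_radius q P x HP Hx). assert (R2 := harnack_coeff_radius).
  assert (Rd : Rbar_le 1 (CV_radius d)).
  { apply CV_radius_minus; [exact R1|now apply CV_radius_mult_const]. }
  assert (Pd : forall s, 0 <= s < 1 -> 0 <= PSeries d s).
  { intros s Hs. unfold d. rewrite PSeries_minus_mult by auto.
    rewrite harnack_coeff_PSeries by exact Hs. unfold PSeries.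
    rewrite (is_series_unique _ _ (is_series_radial q P x s HP Hx Hs)).
    assert (H := harnack_lower q P (s * x)%C HP Ppos Hq0).
    rewrite Cmod_mult, Cmod_R, Rabs_pos_eq, Hx, Rmult_1_r in H by lra.
    assert (H' := H (unit_disk_scal s x Hs ltac:(lra))). fold k in H'. lra. }
  assert (one : 0 <= 1) by lra.
  assert (A1 := averaging_nonneg 1 _ one Rd Pd).
  assert (Rd1 := averaging_radius 1 _ one Rd).
  assert (A2 := averaging_nonneg 1 _ one Rd1 A1).
  assert (Rd2 := averaging_radius 1 _ one Rd1).
  assert (A3 := averaging_nonneg c _ Hc Rd2 A2 t Ht).
  apply Rminus_le_0. rewrite <- PSeries_minus_mult by auto using averaging_radius_twice.
  erewrite PSeries_ext; [exact A3|]. intros n. cbv beta. unfold d.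
  assert (H1 := avg_denom_pos c n Hc). assert (H2 := pos_INR n).
  field. lra.
Qed.

(** A positive constant is obtained by weakening [(1 - t) / (1 + t)] to
    [(1 - t) ^ 2], whose first average [1 - t + t ^ 2 / 3] is at least [1 / 3];
    the second average fixes constants. *)
Lemma radial_minorant_once (q : nat -> C) (P : C -> C) (x : C) (c t : R) :
  power_series_on_disk q P -> (forall z, unit_disk z -> 0 <= Re (P z)) ->
  Im (q 0%nat) = 0 -> Cmod x = 1 -> 0 <= c -> 0 <= t < 1 ->
  Re (q 0%nat) / 3
  <= PSeries (fun n => Re (q n * x ^ n)%C / (1 + INR n) / (1 + c * INR n)) t.
Proof.
  intros HP Ppos Hq0 Hx Hc Ht.
  set (k := Re (q 0%nat)).
  assert (k0 : 0 <= k).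
  { unfold k. rewrite <- (power_series_0 _ _ HP). apply Ppos.
    unfold unit_disk. rewrite Cmod_0. lra. }
  (* the coefficients of [(1 - t) ^ 2] *)
  set (p := fun n : nat => match n with 0 => 1 | 1 => -2 | 2 => 1 | _ => 0 end).
  set (one_c := fun n : nat => match n with O => 1 | S _ => 0 end).
  assert (fin : forall (f : nat -> R) s, (forall n, f (S (S (S n))) = 0) ->
     is_series (fun n => f n * s ^ n) (f 0%nat + f 1%nat * s + f 2%nat * s ^ 2)).
  { intros f s Hf.
    apply (is_series_ext (fun n => plus (plus (if Nat.eqb n 0 then f 0%nat else 0)
       (if Nat.eqb n 1 then f 1%nat * s else 0)) (if Nat.eqb n 2 then f 2%nat * s ^ 2 else 0))).
    - intros [|[|[|n]]]; simpl; unfold plus; simpl; try rewrite Hf; R_ring.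
    - apply (is_series_plus (V := R_NormedModule)); [|apply is_series_single].
      apply (is_series_plus (V := R_NormedModule)); apply is_series_single. }
  assert (bdd : forall f : nat -> R, (forall n, f (S (S (S n))) = 0) ->
     Rbar_le 1 (CV_radius f)).
  { intros f Hf. apply CV_radius_ge_1. intros r Hr.
    exists (Rabs (f 0%nat) + Rabs (f 1%nat) + Rabs (f 2%nat)). intros n.
    rewrite Rabs_mult.
    assert (Rabs (r ^ n) <= 1).
    { rewrite <- RPow_abs, Rabs_pos_eq by lra. rewrite <- (pow1 n). apply pow_incr. lra. }
    assert (H0 := Rabs_pos (r ^ n)).
    assert (HA := Rabs_pos (f 0%nat)). assert (HB := Rabs_pos (f 1%nat)).
    assert (HC := Rabs_pos (f 2%nat)).
    destruct n as [|[|[|n]]]; try nra. rewrite Hf, Rabs_R0. lra. }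
  set (d := fun n => Re (q n * x ^ n)%C - k * p n).
  assert (R1 := radial_radius q P x HP Hx).
  assert (Rp : Rbar_le 1 (CV_radius p)) by (apply bdd; reflexivity).
  assert (Rd : Rbar_le 1 (CV_radius d)).
  { apply CV_radius_minus; [exact R1|now apply CV_radius_mult_const]. }
  assert (Pd : forall s, 0 <= s < 1 -> 0 <= PSeries d s).
  { intros s Hs. unfold d. rewrite PSeries_minus_mult by auto. unfold PSeries.
    rewrite (is_series_unique _ _ (is_series_radial q P x s HP Hx Hs)).
    rewrite (is_series_unique _ _ (fin p s (fun n => eq_refl))). simpl p.
    assert (H := harnack_lower q P (s * x)%C HP Ppos Hq0).
    rewrite Cmod_mult, Cmod_R, Rabs_pos_eq, Hx, Rmult_1_r in H by lra.
    assert (H' := H (unit_disk_scal s x Hs ltac:(lra))). fold k in H'.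
    assert (Hm : (1 - s) ^ 2 <= (1 - s) / (1 + s)).
    { apply Rmult_le_reg_r with (1 + s); [lra|].
      replace ((1 - s) / (1 + s) * (1 + s)) with (1 - s) by (field; lra).
      assert (0 <= s * s * (1 - s)) by (apply Rmult_le_pos; nra). nra. }
    apply Rmult_le_compat_l with (r := k) in Hm; [|exact k0]. nra. }
  assert (one : 0 <= 1) by lra.
  set (a1 := fun n => Re (q n * x ^ n)%C / (1 + 1 * INR n)).
  set (p1 := fun n => p n / (1 + 1 * INR n)).
  assert (Ra1 : Rbar_le 1 (CV_radius a1)) by now apply averaging_radius.
  assert (Rp1 : Rbar_le 1 (CV_radius p1)) by now apply averaging_radius.
  assert (Ro : Rbar_le 1 (CV_radius one_c)) by (apply bdd; reflexivity).
  set (e := fun n => a1 n - (k / 3) * one_c n).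
  assert (Re' : Rbar_le 1 (CV_radius e)).
  { apply CV_radius_minus; [exact Ra1|now apply CV_radius_mult_const]. }
  assert (Pe : forall s, 0 <= s < 1 -> 0 <= PSeries e s).
  { intros s Hs. unfold e. rewrite PSeries_minus_mult by auto.
    assert (A1 := averaging_nonneg 1 _ one Rd Pd s Hs).
    rewrite (PSeries_ext _ (fun n => a1 n - k * p1 n)) in A1.
    2:{ intros n. unfold d, a1, p1. assert (H2 := pos_INR n). field. lra. }
    rewrite PSeries_minus_mult in A1 by auto.
    assert (Ep : PSeries p1 s = 1 - s + s ^ 2 / 3).
    { unfold PSeries. erewrite is_series_unique by
        (apply (fin p1 s); intros n; unfold p1; simpl p; unfold Rdiv; ring).
      unfold p1; simpl. field. }
    assert (Eo : PSeries one_c s = 1).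
    { unfold PSeries. erewrite is_series_unique by
        (apply (fin one_c s); intros n; reflexivity).
      simpl. ring. }
    rewrite Ep in A1. rewrite Eo.
    assert (0 <= k * ((1 - s) * (2 - s))) by (apply Rmult_le_pos; nra). nra. }
  assert (A2 := averaging_nonneg c _ Hc Re' Pe t Ht).
  rewrite (PSeries_ext _ (fun n => a1 n / (1 + c * INR n) - (k / 3) * one_c n)) in A2.
  2:{ intros n. unfold e. assert (H1 := avg_denom_pos c n Hc).
      destruct n as [|n]; simpl one_c; [simpl INR; field|field; lra]. }
  rewrite PSeries_minus_mult in A2; auto.
  2:{ now apply averaging_radius. }
  assert (Eo : PSeries one_c t = 1).
  { unfold PSeries. erewrite is_series_unique by
      (apply (fin one_c t); intros n; reflexivity).
    simpl. ring. }
  rewrite Eo in A2.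
  erewrite PSeries_ext; [apply Rminus_le_0; rewrite Rmult_1_r in A2; exact A2|].
  intros n. unfold a1. now rewrite Rmult_1_l.
Qed.

(** * The differential operator on power series *)

Lemma power_series_plus (a b : nat -> C) (h k : C -> C) :
  power_series_on_disk a h -> power_series_on_disk b k ->
  power_series_on_disk (fun n => a n + b n)%C (fun z => h z + k z)%C.
Proof.
  intros Ha Hb z Hz.
  eapply is_series_ext; [|exact (is_series_plus _ _ _ _ (Ha z Hz) (Hb z Hz))].
  intros n. C_ring.
Qed.

Lemma power_series_scal (c : C) (a : nat -> C) (h : C -> C) :
  power_series_on_disk a h ->
  power_series_on_disk (fun n => c * a n)%C (fun z => c * h z)%C.
Proof.
  intros Ha z Hz.
  eapply is_series_ext; [|exact (is_series_scal c _ _ (Ha z Hz))].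
  intros n. C_ring.
Qed.

Definition shift_coeff (a : nat -> C) (n : nat) : C :=
  match n with O => 0%C | S k => a k end.

Lemma power_series_mult_z (a : nat -> C) (h : C -> C) :
  power_series_on_disk a h ->
  power_series_on_disk (shift_coeff a) (fun z => z * h z)%C.
Proof.
  intros Ha z Hz.
  assert (H := is_series_scal z _ _ (Ha z Hz)).
  replace (z * h z)%C with (shift_coeff a 0 * z ^ 0 + z * h z)%C by (simpl; ring).
  apply (is_series_unshift_C (fun n => shift_coeff a n * z ^ n)%C).
  eapply is_series_ext; [|exact H]. intros n. C_ring.
Qed.

Lemma power_series_ext (a b : nat -> C) (h k : C -> C) :
  (forall n, a n = b n) -> (forall z, unit_disk z -> h z = k z) ->
  power_series_on_disk a h -> power_series_on_disk b k.
Proof.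
  intros Hab Hhk Ha z Hz. rewrite <- Hhk by exact Hz.
  eapply is_series_ext; [|exact (Ha z Hz)]. intros n. cbv beta. now rewrite Hab.
Qed.

Lemma power_series_const (c : C) :
  power_series_on_disk (fun n => match n with O => c | S _ => 0%C end) (fun _ => c).
Proof.
  intros z Hz. apply is_series_ReIm.
  - apply (is_series_ext (fun n => if Nat.eqb n 0 then Re c else 0));
      [|apply is_series_single].
    intros [|n]; unfold Re; simpl; ring.
  - apply (is_series_ext (fun n => if Nat.eqb n 0 then Im c else 0));
      [|apply is_series_single].
    intros [|n]; unfold Im; simpl; ring.
Qed.

(** The multiplier of [class_op] on the monomial of degree [n + 1]. *)
Definition op_coeff (gamma delta : R) (n : nat) : R := denom gamma delta (S n) / 2.

Lemma class_op_power_series (gamma delta : R) (a : nat -> C) (h : C -> C) :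
  power_series_on_disk a h ->
  power_series_on_disk (fun n => op_coeff gamma delta n * a (S n))%C
    (class_op gamma delta h).
Proof.
  intros Ha.
  assert (H1 := power_series_C_derive _ _ Ha).
  assert (H2 := power_series_C_derive _ _ H1).
  assert (H3 := power_series_C_derive _ _ H2).
  assert (T := power_series_plus _ _ _ _
     (power_series_plus _ _ _ _ (power_series_scal gamma _ _ H1)
        (power_series_scal delta _ _ (power_series_mult_z _ _ H2)))
     (power_series_scal (((delta - gamma) / 2)%R) _ _
        (power_series_mult_z _ _ (power_series_mult_z _ _ H3)))).
  eapply power_series_ext; [| |exact T].
  - intros n. cbv beta.
    replace (RtoC (op_coeff gamma delta n)) with
      (gamma * INR (S n) + delta * (INR n * INR (S n))
        + ((delta - gamma) / 2)%R * (INR n * (INR n - 1) * INR (S n)))%C.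
    + destruct n as [|[|n]]; unfold shift_coeff, deriv_coeff.
      * simpl. ring.
      * simpl. rewrite RtoC_plus. ring.
      * replace (INR (S (S n))) with (INR n + 2) by (rewrite !S_INR; ring).
        replace (INR (S (S (S n)))) with (INR n + 3) by (rewrite !S_INR; ring).
        replace (INR (S n)) with (INR n + 1) by (rewrite !S_INR; ring).
        rewrite !RtoC_plus. ring.
    + rewrite <- !RtoC_mult, <- !RtoC_minus, <- !RtoC_mult, <- !RtoC_plus.
      f_equal. unfold op_coeff, denom. rewrite S_INR. field.
  - intros z _. unfold class_op. ring.
Qed.

(** The Taylor sequence counted from degree zero, the form in which series are
    differentiated termwise. *)
Definition full_coeff (c1 : C) (a : nat -> C) (n : nat) : C :=
  match n with O => 0%C | S O => c1 | _ => a n end.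

Lemma expansion_power_series (c1 : C) (a : nat -> C) (h : C -> C) :
  has_expansion c1 a h -> power_series_on_disk (full_coeff c1 a) h.
Proof.
  intros Ha z Hz. specialize (Ha z Hz).
  replace (h z) with (full_coeff c1 a 0 * z ^ 0 + (full_coeff c1 a 1 * z ^ 1
     + (h z - c1 * z)))%C by (simpl; ring).
  apply (is_series_unshift_C (fun n => full_coeff c1 a n * z ^ n)%C).
  apply (is_series_unshift_C (fun n => full_coeff c1 a (S n) * z ^ S n)%C).
  exact Ha.
Qed.

(** * Consequences of membership in the class *)

Record admissible (gamma delta lambda : R) : Prop := {
  lambda_nonneg : 0 <= lambda;
  lambda_lt_gamma : lambda < gamma;
  gamma_le_delta : gamma <= delta }.

Definition major_coeff (gamma delta lambda : R) (m : nat) : R :=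
  4 * (gamma - lambda) / denom gamma delta m.

(** This factorisation turns division by the multiplier into three averages. *)
Lemma op_coeff_factor (gamma delta : R) (n : nat) : 0 < gamma ->
  op_coeff gamma delta n
  = gamma * ((1 + INR n) * (1 + INR n) * (1 + (delta - gamma) / (2 * gamma) * INR n)).
Proof. intros H. unfold op_coeff, denom. rewrite S_INR. field. lra. Qed.

Lemma op_coeff_pos (gamma delta : R) (n : nat) : 0 < gamma -> gamma <= delta ->
  0 < op_coeff gamma delta n.
Proof.
  intros H1 H2. unfold op_coeff, denom. rewrite S_INR.
  assert (H := pos_INR n).
  apply Rdiv_lt_0_compat; [|lra].
  apply Rmult_lt_0_compat; [apply pow_lt; lra|]. nra.
Qed.

Lemma ratio_nonneg (gamma delta : R) : 0 < gamma -> gamma <= delta ->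
  0 <= (delta - gamma) / (2 * gamma).
Proof. intros H1 H2. apply Rdiv_le_0_compat; lra. Qed.

Section Class.

Variables gamma delta lambda : R.
Hypothesis adm : admissible gamma delta lambda.
Variables (h g : C -> C) (a b : nat -> C).
Hypothesis Hclass : in_RH0 gamma delta lambda h g.
Hypothesis Ha : has_expansion 1%C a h.
Hypothesis Hb : has_expansion 0%C b g.

(** The function whose real part is made positive by the class condition,
    after the rotation [u] has turned the harmonic map into an analytic one. *)
Definition rotated_op (u z : C) : C :=
  (class_op gamma delta h z + u * class_op gamma delta g z - lambda)%C.

Definition rotated_coeff (u : C) (n : nat) : C :=
  (op_coeff gamma delta n * (full_coeff 1 a (S n) + u * full_coeff 0 b (S n))
   - match n with O => RtoC lambda | S _ => 0 end)%C.

Let gamma_pos : 0 < gamma.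
Proof. destruct adm. lra. Qed.

Lemma rotated_power_series (u : C) :
  power_series_on_disk (rotated_coeff u) (rotated_op u).
Proof.
  assert (H1 := class_op_power_series gamma delta _ _ (expansion_power_series _ _ _ Ha)).
  assert (H2 := class_op_power_series gamma delta _ _ (expansion_power_series _ _ _ Hb)).
  assert (T := power_series_plus _ _ _ _
     (power_series_plus _ _ _ _ H1 (power_series_scal u _ _ H2))
     (power_series_const (- lambda)%C)).
  eapply power_series_ext; [| |exact T].
  - intros n. unfold rotated_coeff. destruct n; simpl; ring.
  - intros z _. unfold rotated_op. ring.
Qed.

Lemma rotated_op_nonneg (u z : C) :
  Cmod u = 1 -> unit_disk z -> 0 <= Re (rotated_op u z).
Proof.
  intros Hu Hz. assert (H := proj2 Hclass z Hz).
  unfold rotated_op.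
  assert (H1 := re_le_Cmod (u * class_op gamma delta g z)%C).
  rewrite Cmod_mult, Hu in H1. apply Rabs_le_between in H1.
  unfold Re, Cminus, Cplus, Copp in *. simpl in *. lra.
Qed.

Lemma rotated_coeff_0 (u : C) : rotated_coeff u 0 = RtoC (gamma - lambda).
Proof.
  unfold rotated_coeff, op_coeff, denom. simpl full_coeff.
  replace (INR 1 ^ 2 * (2 * gamma + (delta - gamma) * (INR 1 - 1)) / 2) with gamma
    by (simpl; field).
  rewrite RtoC_minus. ring.
Qed.

Lemma rotated_coeff_S (u : C) (n : nat) : rotated_coeff u (S n)
  = (op_coeff gamma delta (S n) * (a (S (S n)) + u * b (S (S n))))%C.
Proof. unfold rotated_coeff. simpl. ring. Qed.

Lemma rotated_facts (u : C) :
  Im (rotated_coeff u 0) = 0 /\ Re (rotated_coeff u 0) = gamma - lambda.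
Proof. rewrite rotated_coeff_0. now rewrite re_RtoC, im_RtoC. Qed.

(** The rotation [u] is chosen so that [a m] and [u * b m] have the same
    direction. *)
Lemma class_coeff_bound (m : nat) : (2 <= m)%nat ->
  Cmod (a m) + Cmod (b m) <= major_coeff gamma delta lambda m.
Proof.
  intros Hm. destruct m as [|[|n]]; try lia.
  destruct (polar_form (a (S (S n)))) as [p [Hp Ep]].
  destruct (polar_form (b (S (S n)))) as [s [Hs Es]].
  set (u := (p * Cconj s)%C).
  assert (Hu : Cmod u = 1).
  { unfold u. rewrite Cmod_mult, Cmod_conj, Hp, Hs. ring. }
  destruct (rotated_facts u) as [F1 F2].
  assert (B := caratheodory_bound _ _ (S n) (rotated_power_series u)
    (fun z => rotated_op_nonneg u z Hu) F1 ltac:(lia)).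
  rewrite F2, rotated_coeff_S in B.
  replace (a (S (S n)) + u * b (S (S n)))%C with
    (RtoC (Cmod (a (S (S n))) + Cmod (b (S (S n)))) * p)%C in B.
  2:{ rewrite Ep at 2. rewrite Es at 2. unfold u.
      replace (p * Cconj s * (Cmod (b (S (S n))) * s))%C with
        (p * Cmod (b (S (S n))) * (s * Cconj s))%C by ring.
      rewrite Cconj_mult_unit by exact Hs. rewrite RtoC_plus. ring. }
  rewrite !Cmod_mult, Hp, !Cmod_R in B.
  destruct adm as [A1 A2 A3].
  assert (O := op_coeff_pos gamma delta (S n) gamma_pos A3).
  rewrite (Rabs_pos_eq (op_coeff _ _ _)) in B by lra.
  assert (C1 := Cmod_ge_0 (a (S (S n)))). assert (C2 := Cmod_ge_0 (b (S (S n)))).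
  rewrite Rabs_pos_eq in B by lra.
  unfold major_coeff. unfold op_coeff in O, B.
  apply Rmult_le_reg_r with (denom gamma delta (S (S n)) / 2); [exact O|].
  replace (4 * (gamma - lambda) / denom gamma delta (S (S n))
    * (denom gamma delta (S (S n)) / 2)) with (2 * (gamma - lambda)) by (field; lra).
  lra.
Qed.

(** The growth minorant [Phi]. *)
Definition minor_fun (t : R) : R :=
  t + Series_from 2 (fun m => (-1) ^ (m - 1) * major_coeff gamma delta lambda m * t ^ m).

Lemma Re_rotated_split (u x : C) (n : nat) :
  Re (rotated_coeff u n * x ^ n)%C =
  op_coeff gamma delta n *
    Re ((full_coeff 1 a (S n) + u * full_coeff 0 b (S n)) * x ^ n)%C
  - match n with O => lambda | S _ => 0 end.
Proof.
  unfold rotated_coeff. rewrite <- re_scal_l.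
  destruct n; unfold Re; simpl; ring.
Qed.

Lemma rotated_growth (u x : C) (t : R) :
  Cmod u = 1 -> Cmod x = 1 -> 0 <= t < 1 ->
  minor_fun t <= Re ((h (t * x) + u * g (t * x)) * Cconj x)%C.
Proof.
  intros Hu Hx Ht.
  destruct adm as [A1 A2 A3].
  set (c := (delta - gamma) / (2 * gamma)).
  assert (Hc : 0 <= c) by now apply ratio_nonneg.
  destruct (rotated_facts u) as [F1 F2].
  assert (M := radial_minorant_twice _ _ x c t (rotated_power_series u)
    (fun z => rotated_op_nonneg u z Hu) F1 Hx Hc Ht).
  rewrite F2 in M.
  assert (Hd : unit_disk (t * x)%C) by (apply unit_disk_scal; lra).
  assert (Hpos : forall n, 0 < 1 + c * INR n /\ 0 < 1 + INR n).
  { intros n. generalize (pos_INR n) (avg_denom_pos c n Hc). lra. }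
  set (Q := PSeries (fun n => Re (rotated_coeff u n * x ^ n)%C
     / (1 + INR n) / (1 + INR n) / (1 + c * INR n)) t) in *.
  assert (SF : is_series (fun n =>
     Re ((full_coeff 1 a (S n) + u * full_coeff 0 b (S n)) * x ^ n)%C * t ^ n * t)
     (Re ((h (t * x) + u * g (t * x)) * Cconj x)%C)).
  { assert (S0 := power_series_plus _ _ _ _ (expansion_power_series _ _ _ Ha)
       (power_series_scal u _ _ (expansion_power_series _ _ _ Hb)) _ Hd).
    cbv beta in S0.
    assert (S1 := is_series_shift_C _ _ S0).
    refine (is_series_eq _ _ _ _ (is_series_Re _ _ (is_series_scal_C (Cconj x) _ _ S1)) _ _).
    2:{ f_equal. simpl full_coeff. ring. }
    intros n. cbv beta.
    rewrite <- !re_scal_r. f_equal. rewrite RtoC_pow, Cpow_mult_l, !Cpow_S.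
    transitivity ((full_coeff 1 a (S n) + u * full_coeff 0 b (S n)) * (t * t ^ n)
       * x ^ n * (x * Cconj x))%C; [ring|].
    rewrite Cconj_mult_unit by exact Hx. ring. }
  assert (EQ : Re ((h (t * x) + u * g (t * x)) * Cconj x)%C
               = t / gamma * (lambda + Q)).
  { rewrite <- (is_series_unique _ _ SF).
    assert (RS : Rbar_le 1 (CV_radius (fun n => Re (rotated_coeff u n * x ^ n)%C
         / (1 + INR n) / (1 + INR n) / (1 + c * INR n)))).
    { apply averaging_radius_twice; [exact Hc|].
      exact (radial_radius _ _ x (rotated_power_series u) Hx). }
    assert (ES : ex_series (fun n => Re (rotated_coeff u n * x ^ n)%C
         / (1 + INR n) / (1 + INR n) / (1 + c * INR n) * t ^ n)).
    { apply ex_series_Rabs, ex_series_inside; [exact RS|rewrite Rabs_pos_eq; lra]. }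
    assert (SQ := Series_correct _ ES).
    assert (S3 := is_series_mult_l (t / gamma) _ _
        (is_series_plus _ _ _ _ (is_series_single 0 lambda) SQ)).
    change (plus lambda ?w) with (lambda + w) in S3.
    change (Series _) with Q in S3 at 1.
    apply is_series_unique. eapply is_series_ext; [|exact S3].
    intros n. cbv beta. rewrite Re_rotated_split, op_coeff_factor by exact gamma_pos.
    destruct (Hpos n) as [P1 P2]. fold c.
    unfold plus; simpl. destruct n as [|n]; simpl Nat.eqb; cbv iota.
    - simpl. field. lra.
    - field. lra. }
  assert (EM : minor_fun t = t / gamma * (lambda + (gamma - lambda) *
     PSeries (fun n => harnack_coeff n / (1 + INR n) / (1 + INR n) / (1 + c * INR n)) t)).
  { assert (RS := averaging_radius_twice c _ Hc harnack_coeff_radius).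
    assert (Ht' : Rabs t < 1) by (rewrite Rabs_pos_eq; lra).
    assert (ES := ex_series_Rabs _ (ex_series_inside _ _ RS Ht')).
    unfold PSeries. rewrite (Series_incr_1 _ ES).
    unfold minor_fun, Series_from.
    rewrite (Series_ext (fun k => (-1) ^ (2 + k - 1) * major_coeff gamma delta lambda (2 + k)
        * t ^ (2 + k)) (fun n => (t / gamma * (gamma - lambda)) *
       (harnack_coeff (S n) / (1 + INR (S n)) / (1 + INR (S n)) / (1 + c * INR (S n))
         * t ^ S n))).
    2:{ intros n. replace (2 + n - 1)%nat with (S n) by lia.
        unfold major_coeff. change (2 + n)%nat with (S (S n)).
        replace (denom gamma delta (S (S n))) with (2 * op_coeff gamma delta (S n))
          by (unfold op_coeff; field).
        rewrite op_coeff_factor by exact gamma_pos. fold c.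
        change (harnack_coeff (S n)) with (2 * (-1) ^ S n).
        destruct (Hpos (S n)) as [P1 P2].
        change (t ^ S (S n)) with (t * t ^ S n). field. lra. }
    rewrite Series_scal_l. set (S0 := Series _).
    change (harnack_coeff 0) with 1. change (INR 0) with 0. change (t ^ 0) with 1.
    field. lra. }
  rewrite EQ, EM. apply Rmult_le_compat_l.
  - apply Rdiv_le_0_compat; lra.
  - lra.
Qed.

(** Here [lambda] is the constant removed from the operator, and one third of
    [gamma - lambda] survives the two averages. *)
Definition jacobian_bound : R := (lambda + (gamma - lambda) / 3) / gamma.

Lemma rotated_jacobian (u x : C) (t : R) :
  Cmod u = 1 -> Cmod x = 1 -> 0 <= t < 1 ->
  jacobian_bound <= Re (C_derive h (t * x) + u * C_derive g (t * x))%C.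
Proof.
  intros Hu Hx Ht.
  destruct adm as [A1 A2 A3].
  set (c := (delta - gamma) / (2 * gamma)).
  assert (Hc : 0 <= c) by now apply ratio_nonneg.
  destruct (rotated_facts u) as [F1 F2].
  assert (M := radial_minorant_once _ _ x c t (rotated_power_series u)
    (fun z => rotated_op_nonneg u z Hu) F1 Hx Hc Ht).
  rewrite F2 in M.
  assert (Hd : unit_disk (t * x)%C) by (apply unit_disk_scal; lra).
  assert (Hpos : forall n, 0 < 1 + c * INR n /\ 0 < 1 + INR n).
  { intros n. generalize (pos_INR n) (avg_denom_pos c n Hc). lra. }
  set (Q := PSeries (fun n => Re (rotated_coeff u n * x ^ n)%C
     / (1 + INR n) / (1 + c * INR n)) t) in *.
  assert (EQ : Re (C_derive h (t * x) + u * C_derive g (t * x))%C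
               = / gamma * (lambda + Q)).
  { assert (PS := power_series_plus _ _ _ _
       (power_series_C_derive _ _ (expansion_power_series _ _ _ Ha))
       (power_series_scal u _ _
          (power_series_C_derive _ _ (expansion_power_series _ _ _ Hb)))).
    rewrite <- (is_series_unique _ _ (is_series_radial _ _ x t PS Hx Ht)).
    assert (RS := averaging_radius_once c _ Hc
                    (radial_radius _ _ x (rotated_power_series u) Hx)).
    assert (ES : ex_series (fun n => Re (rotated_coeff u n * x ^ n)%C
         / (1 + INR n) / (1 + c * INR n) * t ^ n)).
    { apply ex_series_Rabs, ex_series_inside; [exact RS|rewrite Rabs_pos_eq; lra]. }
    assert (S3 := is_series_mult_l (/ gamma) _ _
        (is_series_plus _ _ _ _ (is_series_single 0 lambda) (Series_correct _ ES))).
    apply is_series_unique.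
    refine (is_series_eq _ _ _ _ S3 _ _); [|reflexivity].
    intros n. cbv beta. rewrite Re_rotated_split, op_coeff_factor by exact gamma_pos.
    replace (Re ((deriv_coeff (full_coeff 1 a) n + u * deriv_coeff (full_coeff 0 b) n)
       * x ^ n)%C) with ((1 + INR n) *
       Re ((full_coeff 1 a (S n) + u * full_coeff 0 b (S n)) * x ^ n)%C).
    2:{ rewrite <- re_scal_l. f_equal. unfold deriv_coeff.
        rewrite S_INR, !RtoC_plus. ring. }
    destruct (Hpos n) as [P1 P2]. fold c.
    unfold plus; simpl. destruct n as [|n]; simpl Nat.eqb; cbv iota.
    - simpl. field. lra.
    - field. lra. }
  rewrite EQ. unfold jacobian_bound.
  unfold Rdiv at 1. rewrite Rmult_comm. apply Rmult_le_compat_l; [|lra].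
  left. apply Rinv_0_lt_compat. exact gamma_pos.
Qed.

Lemma polar_in_disk (z : C) : unit_disk z ->
  exists x, Cmod x = 1 /\ z = (Cmod z * x)%C /\ 0 <= Cmod z < 1.
Proof.
  intros Hz. destruct (polar_form z) as [x [Hx Ex]]. exists x.
  repeat split; auto using Cmod_ge_0.
Qed.

(** The rotation [u] is chosen so that [u * g z] points against [z]; then the
    bound for [h + u g] becomes one for [|h z| - |g z|]. *)
Lemma class_growth (z : C) : unit_disk z ->
  minor_fun (Cmod z) <= Cmod (harmonic_map h g z).
Proof.
  intros Hz. destruct (polar_in_disk z Hz) as [x [Hx [Ex Hr]]].
  destruct (polar_form (g z)) as [p [Hp Ep]].
  set (u := (- (Cconj p * x))%C).
  assert (Hu : Cmod u = 1).
  { unfold u. rewrite Cmod_opp, Cmod_mult, Cmod_conj, Hp, Hx. ring. }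
  assert (H := rotated_growth u x (Cmod z) Hu Hx Hr). rewrite <- Ex in H.
  replace ((h z + u * g z) * Cconj x)%C with (h z * Cconj x - Cmod (g z))%C in H.
  2:{ rewrite Ep at 2. unfold u.
      transitivity (h z * Cconj x - Cmod (g z) * (p * Cconj p) * (x * Cconj x))%C; [|ring].
      rewrite !Cconj_mult_unit by assumption. ring. }
  assert (H1 : Re (h z * Cconj x)%C <= Cmod (h z)).
  { eapply Rle_trans; [apply Rle_abs|]. eapply Rle_trans; [apply re_le_Cmod|].
    rewrite Cmod_mult, Cmod_conj, Hx. lra. }
  assert (H2 : Cmod (h z) <= Cmod (harmonic_map h g z) + Cmod (g z)).
  { replace (h z) with (harmonic_map h g z + - Cconj (g z))%C
      by (unfold harmonic_map; ring).
    eapply Rle_trans; [apply Cmod_triangle|]. rewrite Cmod_opp, Cmod_conj. lra. }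
  replace (Re (h z * Cconj x - Cmod (g z))%C) with
    (Re (h z * Cconj x)%C - Cmod (g z)) in H by reflexivity.
  lra.
Qed.

Lemma class_jacobian (z : C) : unit_disk z ->
  jacobian_bound + Cmod (C_derive g z) <= Re (C_derive h z).
Proof.
  intros Hz. destruct (polar_in_disk z Hz) as [x [Hx [Ex Hr]]].
  destruct (polar_form (C_derive g z)) as [p [Hp Ep]].
  set (u := (- Cconj p)%C).
  assert (Hu : Cmod u = 1).
  { unfold u. now rewrite Cmod_opp, Cmod_conj. }
  assert (H := rotated_jacobian u x (Cmod z) Hu Hx Hr). rewrite <- Ex in H.
  replace (u * C_derive g z)%C with (RtoC (- Cmod (C_derive g z))) in H.
  2:{ rewrite Ep at 2. unfold u.
      transitivity (- (Cmod (C_derive g z) * (p * Cconj p)))%C; [|ring].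
      rewrite Cconj_mult_unit by assumption. rewrite RtoC_opp. ring. }
  replace (Re (C_derive h z + RtoC (- Cmod (C_derive g z)))%C) with
    (Re (C_derive h z) + - Cmod (C_derive g z)) in H by reflexivity.
  lra.
Qed.

Lemma jacobian_bound_pos : 0 < jacobian_bound.
Proof.
  unfold jacobian_bound. destruct adm. apply Rdiv_lt_0_compat; lra.
Qed.

End Class.

(** * Quantitative openness of harmonic maps *)

(** Solution [x] of [p x + conj (q x) = y], by Cramer's rule for [x] and its
    conjugate. *)
Definition conj_linear_solve (p q y : C) : C :=
  ((Cconj p * y - Cconj q * Cconj y) / RtoC (Cmod p ^ 2 - Cmod q ^ 2))%C.

Lemma conj_linear_solve_spec (p q y : C) (m : R) :
  0 < m -> m + Cmod q <= Cmod p ->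
  (p * conj_linear_solve p q y + Cconj (q * conj_linear_solve p q y))%C = y /\
  Cmod (conj_linear_solve p q y) <= Cmod y / m.
Proof.
  intros Hm Hpq.
  assert (q0 := Cmod_ge_0 q). assert (y0 := Cmod_ge_0 y).
  set (d := Cmod p ^ 2 - Cmod q ^ 2).
  assert (Hd : d = (Cmod p - Cmod q) * (Cmod p + Cmod q)) by (unfold d; ring).
  assert (d0 : 0 < d) by (rewrite Hd; apply Rmult_lt_0_compat; lra).
  assert (dn : RtoC d <> 0%C) by (intros E; apply RtoC_inj in E; lra).
  split.
  - unfold conj_linear_solve. fold d.
    rewrite Cmult_conj, Cdiv_conj, Cminus_conj, !Cmult_conj, !Cconj_conj by exact dn.
    replace (Cconj (RtoC d)) with (RtoC d).
    2:{ unfold RtoC, Cconj; simpl. f_equal. ring. }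
    transitivity ((p * Cconj p - q * Cconj q) * y / d)%C.
    { field. exact dn. }
    rewrite <- !Cmod2_conj, <- RtoC_minus. fold d. field. exact dn.
  - unfold conj_linear_solve. fold d.
    rewrite Cmod_div, Cmod_R, Rabs_pos_eq by (auto; lra).
    apply Rle_trans with ((Cmod p + Cmod q) * Cmod y / d).
    + apply Rmult_le_compat_r; [left; now apply Rinv_0_lt_compat|].
      unfold Cminus. eapply Rle_trans; [apply Cmod_triangle|].
      rewrite Cmod_opp, !Cmod_mult, !Cmod_conj. lra.
    + rewrite Hd.
      replace ((Cmod p + Cmod q) * Cmod y / ((Cmod p - Cmod q) * (Cmod p + Cmod q)))
        with (Cmod y * / (Cmod p - Cmod q)) by (field; lra).
      apply Rmult_le_compat_l; [exact y0|]. apply Rinv_le_contravar; lra.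
Qed.

Lemma harmonic_taylor (a b : nat -> C) (h g : C -> C) (rho : R) :
  power_series_on_disk a h -> power_series_on_disk b g -> 0 < rho < 1 ->
  exists K, 0 < K /\ forall z w, Cmod z <= rho -> Cmod w <= rho ->
    Cmod (harmonic_map h g w - harmonic_map h g z
          - (C_derive h z * (w - z) + Cconj (C_derive g z * (w - z))))%C
    <= K * Cmod (w - z)%C ^ 2.
Proof.
  intros Ha Hb Hr.
  destruct (power_series_taylor a h _ rho Ha (power_series_C_derive _ _ Ha) Hr)
    as [K1 [K1p H1]].
  destruct (power_series_taylor b g _ rho Hb (power_series_C_derive _ _ Hb) Hr)
    as [K2 [K2p H2]].
  exists (K1 + K2). split; [lra|]. intros z w Hz Hw.
  specialize (H1 z w Hz Hw). specialize (H2 z w Hz Hw).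
  rewrite <- Cmod_conj in H2.
  replace (harmonic_map h g w - harmonic_map h g z
          - (C_derive h z * (w - z) + Cconj (C_derive g z * (w - z))))%C with
    ((h w - h z - C_derive h z * (w - z))
     + Cconj (g w - g z - C_derive g z * (w - z)))%C.
  - eapply Rle_trans; [apply Cmod_triangle|]. lra.
  - unfold harmonic_map. rewrite !Cminus_conj. ring.
Qed.

(** Newton's iteration for the equation [harmonic_map h g z = v]; the real
    differential is inverted by [conj_linear_solve]. *)
Definition newton_step (h g : C -> C) (v z : C) : C :=
  (z + conj_linear_solve (C_derive h z) (C_derive g z) (v - harmonic_map h g z))%C.

Lemma Cmod_triangle_3 (x y z : C) : Cmod (x - z)%C <= Cmod (x - y)%C + Cmod (y - z)%C.
Proof. replace (x - z)%C with ((x - y) + (y - z))%C by ring. apply Cmod_triangle. Qed.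

Lemma C_geometric_steps_converge (z : nat -> C) (A : R) :
  (forall n, Cmod (z (S n) - z n)%C <= A * (/ 2) ^ n) ->
  exists l, forall eps, 0 < eps -> exists n, forall k, (n <= k)%nat ->
    Cmod (z k - l)%C < eps.
Proof.
  intros H.
  assert (E : ex_series (fun n => A * (/ 2) ^ n)).
  { apply ex_series_mult_l, ex_series_geom. rewrite Rabs_pos_eq; lra. }
  destruct (ex_series_Cmod _ _ H E) as [l Hl].
  exists (z 0%nat + l)%C. intros eps He.
  assert (S1 : forall n, sum_n (G := C_NormedModule) (fun n => z (S n) - z n)%C n
                         = (z (S n) - z 0%nat)%C).
  { induction n as [|n IH].
    - now rewrite sum_O.
    - rewrite sum_Sn, IH. C_ring. }
  destruct (proj1 (filterlim_locally_ball_norm _ _) Hl (mkposreal eps He)) as [n Hn].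
  exists (S n). intros k Hk. destruct k as [|k]; [lia|].
  specialize (Hn k ltac:(lia)). rewrite S1 in Hn.
  change (Cmod (z (S k) - z 0%nat - l)%C < eps) in Hn.
  now replace (z (S k) - (z 0%nat + l))%C with (z (S k) - z 0%nat - l)%C by ring.
Qed.

(** Newton's iteration started at [z] converges: the lower bound [m] for the
    differential controls the steps, and the quadratic remainder halves the
    residual each time. All constants depend on [r0] only, which is what allows
    the starting point to vary later. *)
Lemma harmonic_uniformly_open (a b : nat -> C) (h g : C -> C) (m r0 : R) :
  power_series_on_disk a h -> power_series_on_disk b g -> 0 < m ->
  (forall z, unit_disk z -> m + Cmod (C_derive g z) <= Re (C_derive h z)) ->
  0 < r0 < 1 ->
  exists eta, 0 < eta /\ forall z v, Cmod z <= r0 ->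
    Cmod (v - harmonic_map h g z)%C < eta -> image_of_disk (harmonic_map h g) v.
Proof.
  intros Ha Hb Hm Hj Hr.
  set (rho := (1 + r0) / 2). assert (Hrho : 0 < rho < 1) by (unfold rho; lra).
  destruct (harmonic_taylor a b h g rho Ha Hb Hrho) as [K [K0 HK]].
  (* The first bound keeps the iterates inside the disk of radius [rho], the
     second one halves the residual. *)
  set (eta := Rmin (m * (1 - r0) / 8) (m ^ 2 / (2 * K))).
  assert (m2 : 0 < m ^ 2) by nra.
  assert (eta0 : 0 < eta).
  { apply Rmin_glb_lt; [nra|]. apply Rdiv_lt_0_compat; lra. }
  assert (eta1 : eta <= m * (1 - r0) / 8) by apply Rmin_l.
  assert (eta2 : K * eta <= m ^ 2 / 2).
  { assert (E := Rmin_r (m * (1 - r0) / 8) (m ^ 2 / (2 * K))). fold eta in E.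
    apply Rmult_le_compat_l with (r := K) in E; [|lra].
    replace (K * (m ^ 2 / (2 * K))) with (m ^ 2 / 2) in E by (field; lra). exact E. }
  exists eta. split; [exact eta0|]. intros z0 v Hz0 Hv.
  set (f := harmonic_map h g) in *.
  set (z := fun n => Nat.iter n (newton_step h g v) z0).
  set (A := eta / m).
  assert (A0 : 0 < A) by now apply Rdiv_lt_0_compat.
  assert (A1 : A <= (1 - r0) / 8).
  { apply Rmult_le_reg_r with m; [exact Hm|]. unfold A.
    replace (eta / m * m) with eta by (field; lra). lra. }
  assert (half : forall n, 0 < (/ 2) ^ n <= 1).
  { intros n. split; [apply pow_lt; lra|]. rewrite <- (pow1 n). apply pow_incr. lra. }
  assert (Step : forall w, Cmod w <= rho ->
     Cmod (newton_step h g v w - w)%C <= Cmod (v - f w)%C / m /\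
     (Cmod (newton_step h g v w) <= rho ->
      Cmod (v - f (newton_step h g v w))%C
      <= K * Cmod (newton_step h g v w - w)%C ^ 2)).
  { intros w Hw.
    assert (Dw : unit_disk w) by (unfold unit_disk; lra).
    assert (J := Hj w Dw).
    assert (J' : m + Cmod (C_derive g w) <= Cmod (C_derive h w)).
    { eapply Rle_trans; [exact J|]. eapply Rle_trans; [apply Rle_abs|apply re_le_Cmod]. }
    destruct (conj_linear_solve_spec _ _ (v - f w)%C m Hm J') as [E1 E2].
    set (x := conj_linear_solve _ _ _) in *.
    assert (Ex : (newton_step h g v w - w)%C = x) by (unfold newton_step, x; fold f; ring).
    rewrite Ex. split; [exact E2|]. intros Hw'.
    specialize (HK w _ Hw Hw'). rewrite Ex, E1 in HK.
    rewrite Cmod_minus_sym.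
    now replace (f (newton_step h g v w) - v)%C with
      (f (newton_step h g v w) - f w - (v - f w))%C by ring. }
  assert (Inv : forall n, Cmod (z n) <= r0 + 2 * A * (1 - (/ 2) ^ n) /\
     Cmod (v - f (z n))%C <= eta * (/ 2) ^ n /\
     Cmod (z (S n) - z n)%C <= A * (/ 2) ^ n).
  { assert (Aux : forall n, Cmod (z n) <= r0 + 2 * A * (1 - (/ 2) ^ n) ->
       Cmod (v - f (z n))%C <= eta * (/ 2) ^ n ->
       Cmod (z n) <= rho /\ Cmod (z (S n) - z n)%C <= A * (/ 2) ^ n).
    { intros n I1 I2. assert (Hh := half n).
      assert (Hn : Cmod (z n) <= rho) by (unfold rho; nra).
      split; [exact Hn|].
      destruct (Step (z n) Hn) as [S1 _].
      change (newton_step h g v (z n)) with (z (S n)) in S1.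
      eapply Rle_trans; [exact S1|]. unfold A.
      replace (eta / m * (/ 2) ^ n) with (eta * (/ 2) ^ n / m) by (field; lra).
      apply Rmult_le_compat_r; [left; now apply Rinv_0_lt_compat|exact I2]. }
    induction n as [|n [I1 [I2 I3]]].
    - assert (B1 : Cmod (z 0%nat) <= r0 + 2 * A * (1 - (/ 2) ^ 0)) by (simpl; lra).
      assert (B2 : Cmod (v - f (z 0%nat))%C <= eta * (/ 2) ^ 0).
      { change (z 0%nat) with z0. simpl. lra. }
      destruct (Aux 0%nat B1 B2) as [_ B3]. auto.
    - assert (Hh := half n). assert (Hh' := half (S n)).
      assert (B1 : Cmod (z (S n)) <= r0 + 2 * A * (1 - (/ 2) ^ S n)).
      { assert (T := Cmod_le_of_minus (z n) (z (S n))).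
        change ((/ 2) ^ S n) with (/ 2 * (/ 2) ^ n). lra. }
      destruct (Aux n I1 I2) as [Hn _].
      assert (Hn' : Cmod (z (S n)) <= rho) by (unfold rho; nra).
      destruct (Step (z n) Hn) as [_ S2].
      change (newton_step h g v (z n)) with (z (S n)) in S2.
      specialize (S2 Hn').
      assert (B2 : Cmod (v - f (z (S n)))%C <= eta * (/ 2) ^ S n).
      { eapply Rle_trans; [exact S2|].
        apply Rle_trans with (K * (A * (/ 2) ^ n) ^ 2).
        - apply Rmult_le_compat_l; [lra|]. apply pow_incr. split; [apply Cmod_ge_0|exact I3].
        - change ((/ 2) ^ S n) with (/ 2 * (/ 2) ^ n).
          replace (K * (A * (/ 2) ^ n) ^ 2) with
            ((K * eta) * (eta * ((/ 2) ^ n * (/ 2) ^ n) / m ^ 2))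
            by (unfold A; field; lra).
          replace (eta * (/ 2 * (/ 2) ^ n)) with
            (m ^ 2 / 2 * (eta * (/ 2) ^ n / m ^ 2)) by (field; lra).
          assert (X : 0 <= / m ^ 2) by (left; now apply Rinv_0_lt_compat).
          apply Rmult_le_compat.
          + nra.
          + apply Rmult_le_pos; [|exact X]. apply Rmult_le_pos; [lra|]. nra.
          + exact eta2.
          + apply Rmult_le_compat_r; [exact X|].
            apply Rmult_le_compat_l; [lra|]. nra. }
      destruct (Aux (S n) B1 B2) as [_ B3]. auto. }
  destruct (C_geometric_steps_converge z A (fun n => proj2 (proj2 (Inv n)))) as [l Hl].
  assert (Zn : forall n, Cmod (z n) <= rho - (1 - r0) / 4).
  { intros n. destruct (Inv n) as [I1 _]. assert (Hh := half n). unfold rho. nra. }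
  assert (Hlr : Cmod l <= rho).
  { destruct (Hl ((1 - r0) / 4) ltac:(lra)) as [n Hn]. specialize (Hn n (le_n n)).
    assert (T := Cmod_le_of_minus (z n) l). rewrite Cmod_minus_sym in Hn.
    specialize (Zn n). lra. }
  exists l. split; [unfold unit_disk; lra|]. fold f.
  apply Ceq_minus, Cmod_eq_0.
  apply Rle_antisym; [|apply Cmod_ge_0].
  apply le_epsilon. intros eps He. rewrite Rplus_0_l.
  set (L := Cmod (C_derive h l) + Cmod (C_derive g l) + K).
  assert (L0 : 0 < L).
  { unfold L. generalize (Cmod_ge_0 (C_derive h l)) (Cmod_ge_0 (C_derive g l)). lra. }
  assert (e0 : 0 < Rmin 1 (eps / (2 * L))).
  { apply Rmin_glb_lt; [lra|]. apply Rdiv_lt_0_compat; lra. }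
  destruct (Hl _ e0) as [n1 Hn1].
  assert (E2 : exists n2, forall k, (n2 <= k)%nat -> eta * (/ 2) ^ k < eps / 2).
  { assert (P : 0 < eps / (2 * eta)) by (apply Rdiv_lt_0_compat; lra).
    destruct (pow_lt_1_zero (/ 2) ltac:(rewrite Rabs_pos_eq; lra) _ P) as [n2 Hn2].
    exists n2. intros k Hk. specialize (Hn2 k Hk).
    assert (Hh := half k). rewrite Rabs_pos_eq in Hn2 by lra.
    apply Rmult_lt_compat_l with (r := eta) in Hn2; [|exact eta0].
    replace (eta * (eps / (2 * eta))) with (eps / 2) in Hn2 by (field; lra). exact Hn2. }
  destruct E2 as [n2 Hn2].
  set (n := Nat.max n1 n2).
  specialize (Hn1 n ltac:(unfold n; lia)). specialize (Hn2 n ltac:(unfold n; lia)).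
  destruct (Inv n) as [_ [I2 _]].
  assert (D1 := Rlt_le_trans _ _ _ Hn1 (Rmin_l _ _)).
  assert (D2 := Rlt_le_trans _ _ _ Hn1 (Rmin_r _ _)).
  set (x := Cmod (z n - l)%C) in *. assert (x0 : 0 <= x) by apply Cmod_ge_0.
  assert (Q : Cmod (f (z n) - f l)%C <= L * x).
  { assert (T := HK l (z n) Hlr ltac:(specialize (Zn n); lra)). fold x in T.
    set (lin := (C_derive h l * (z n - l) + Cconj (C_derive g l * (z n - l)))%C) in T.
    assert (T2 := Cmod_le_of_minus lin (f (z n) - f l)%C).
    assert (T3 : Cmod lin <= (Cmod (C_derive h l) + Cmod (C_derive g l)) * x).
    { eapply Rle_trans; [apply Cmod_triangle|].
      rewrite Cmod_conj, !Cmod_mult. fold x. lra. }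
    unfold L. assert (x ^ 2 <= x) by nra. nra. }
  assert (Q2 : L * x <= eps / 2).
  { apply Rmult_lt_compat_l with (r := L) in D2; [|exact L0].
    replace (L * (eps / (2 * L))) with (eps / 2) in D2 by (field; lra). lra. }
  assert (T := Cmod_triangle_3 (f l) (f (z n)) v).
  rewrite (Cmod_minus_sym (f l) (f (z n))) in T. rewrite (Cmod_minus_sym (f (z n)) v) in T.
  lra.
Qed.

(** * The distance to the boundary *)

Lemma ex_series_inv_squares : ex_series (fun n => / INR (S n) ^ 2).
Proof.
  apply (ex_series_incr_1 (K := R_AbsRing) (V := R_NormedModule)).
  apply (ex_series_le (K := R_AbsRing) (V := R_CompleteNormedModule) _
           (fun n => / INR (S n) - / INR (S (S n)))).
  - intros n. unfold norm; simpl norm; unfold abs; simpl abs.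
    assert (P1 : 0 < INR (S n)) by (apply lt_0_INR; lia).
    assert (P2 : 0 < INR (S (S n))) by (apply lt_0_INR; lia).
    rewrite Rabs_pos_eq by (left; apply Rinv_0_lt_compat, pow_lt; lra).
    assert (E : INR (S (S n)) = INR (S n) + 1) by apply S_INR.
    set (p := INR (S n)) in *. rewrite E.
    replace (/ p - / (p + 1)) with (/ (p * (p + 1))) by (field; lra).
    apply Rinv_le_contravar; nra.
  - exists 1.
    apply (filterlim_ext (fun n => 1 - / INR (S (S n)))).
    + induction x as [|n IH].
      * rewrite sum_O. simpl. field.
      * rewrite sum_Sn, <- IH. change (plus ?x ?y) with (x + y). ring.
    + assert (L0 : is_lim_seq (fun n => / INR (S (S n))) 0).
      { apply (is_lim_seq_inv (fun n => INR (S (S n))) p_infty); [|discriminate].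
        apply (is_lim_seq_incr_1 (fun n => INR (S n))), (is_lim_seq_incr_1 INR).
        apply is_lim_seq_INR. }
      assert (L1 := is_lim_seq_minus' _ _ _ _ (is_lim_seq_const 1) L0).
      rewrite Rminus_0_r in L1. exact L1.
Qed.

Section Majorant.

Variables gamma delta lambda : R.
Hypothesis adm : admissible gamma delta lambda.

Lemma major_coeff_bounds (m : nat) : (1 <= m)%nat ->
  0 < major_coeff gamma delta lambda m
    <= 2 * (gamma - lambda) / gamma * / INR m ^ 2.
Proof.
  intros Hm. destruct adm as [A1 A2 A3].
  assert (P : 1 <= INR m) by (apply (le_INR 1); exact Hm).
  assert (P2 : 0 < INR m ^ 2) by (apply pow_lt; lra).
  unfold major_coeff, denom.
  set (X := 2 * gamma + (delta - gamma) * (INR m - 1)).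
  assert (HX : 2 * gamma <= X).
  { unfold X. assert (0 <= (delta - gamma) * (INR m - 1)) by (apply Rmult_le_pos; lra). lra. }
  split.
  - apply Rdiv_lt_0_compat; [lra|]. apply Rmult_lt_0_compat; lra.
  - replace (2 * (gamma - lambda) / gamma * / INR m ^ 2)
      with (4 * (gamma - lambda) / INR m ^ 2 * / (2 * gamma)) by (field; lra).
    replace (4 * (gamma - lambda) / (INR m ^ 2 * X))
      with (4 * (gamma - lambda) / INR m ^ 2 * / X) by (field; lra).
    apply Rmult_le_compat_l.
    + apply Rdiv_le_0_compat; lra.
    + apply Rinv_le_contravar; lra.
Qed.

Lemma ex_series_major (N : nat) : (1 <= N)%nat ->
  ex_series (fun k => major_coeff gamma delta lambda (N + k)).
Proof.
  intros HN. destruct N as [|N]; [lia|].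
  apply (ex_series_le (K := R_AbsRing) (V := R_CompleteNormedModule) _
    (fun k => 2 * (gamma - lambda) / gamma * / INR (S (N + k)) ^ 2)).
  - intros k. unfold norm; simpl norm; unfold abs; simpl abs.
    destruct (major_coeff_bounds (S (N + k)) ltac:(lia)) as [B1 B2].
    rewrite Rabs_pos_eq; [exact B2|]. left. exact B1.
  - apply ex_series_mult_l.
    apply (ex_series_incr_n (fun k => / INR (S k) ^ 2) N), ex_series_inv_squares.
Qed.

Lemma ex_series_weighted_major (N : nat) (s : nat -> R) : (1 <= N)%nat ->
  (forall k, Rabs (s k) <= 1) ->
  ex_series (fun k => s k * major_coeff gamma delta lambda (N + k)).
Proof.
  intros HN Hs.
  apply (ex_series_le (K := R_AbsRing) (V := R_CompleteNormedModule) _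
    (fun k => major_coeff gamma delta lambda (N + k))); [|now apply ex_series_major].
  intros k. unfold norm; simpl norm; unfold abs; simpl abs.
  destruct (major_coeff_bounds (N + k) ltac:(lia)) as [B1 _].
  rewrite Rabs_mult, (Rabs_pos_eq (major_coeff _ _ _ _)) by lra.
  specialize (Hs k). nra.
Qed.

Lemma pow_unit_bound (t : R) (n : nat) : 0 <= t <= 1 -> 0 <= t ^ n <= 1.
Proof.
  intros Ht. split; [apply pow_le; lra|]. rewrite <- (pow1 n). apply pow_incr. lra.
Qed.

Lemma minor_fun_left_limit (eps : R) : 0 < eps ->
  exists d, 0 < d < 1 /\ forall t, 1 - d < t < 1 ->
    Rabs (minor_fun gamma delta lambda t - minor_fun gamma delta lambda 1) < eps.
Proof.
  intros He.
  assert (L : filterlim (fun t => Series (fun k => (-1) ^ (2 + k - 1)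
      * major_coeff gamma delta lambda (2 + k) * t ^ (2 + k))) (at_left 1)
      (locally (Series (fun k => (-1) ^ (2 + k - 1)
      * major_coeff gamma delta lambda (2 + k) * 1 ^ (2 + k))))).
  { apply (tannery (at_left 1) _ _ (fun k => major_coeff gamma delta lambda (2 + k))).
    - intros k. eapply filterlim_filter_le_1.
      + apply (filter_le_within (F := locally 1)).
      + assert (C : continuity_pt (fun t => (-1) ^ (2 + k - 1)
          * major_coeff gamma delta lambda (2 + k) * t ^ (2 + k)) 1).
        { apply derivable_continuous_pt.
          apply derivable_pt_mult; [apply derivable_pt_const|apply derivable_pt_pow]. }
        apply continuity_pt_filterlim in C. exact C.
    - exists (mkposreal 1 Rlt_0_1). intros t Ht Ht1 k.
      assert (Ht' : Rabs (t - 1) < 1) by exact Ht. apply Rabs_def2 in Ht'.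
      destruct (major_coeff_bounds (2 + k) ltac:(lia)) as [B1 _].
      assert (B2 := pow_unit_bound t (2 + k) ltac:(lra)).
      rewrite !Rabs_mult, pow_1_abs, (Rabs_pos_eq (major_coeff _ _ _ _)),
        (Rabs_pos_eq (t ^ _)) by lra. nra.
    - apply ex_series_major. lia. }
  assert (e2 : 0 < eps / 2) by lra.
  destruct (proj1 (filterlim_locally _ _) L (mkposreal _ e2)) as [d Hd].
  set (d' := Rmin (Rmin d (eps / 2)) (/ 2)).
  assert (Hd1 : d' <= d) by (eapply Rle_trans; [apply Rmin_l|apply Rmin_l]).
  assert (Hd2 : d' <= eps / 2) by (eapply Rle_trans; [apply Rmin_l|apply Rmin_r]).
  assert (Hd3 : d' <= / 2) by apply Rmin_r.
  exists d'. split.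
  { split; [|lra]. apply Rmin_glb_lt; [|lra]. apply Rmin_glb_lt; [apply cond_pos|lra]. }
  intros t Ht.
  assert (Hb : Rabs (t - 1) < d) by (rewrite Rabs_left; lra).
  specialize (Hd t Hb ltac:(lra)).
  set (S1 := Series (fun k => _ * 1 ^ _)) in Hd.
  change (Rabs (Series (fun k => (-1) ^ (2 + k - 1)
      * major_coeff gamma delta lambda (2 + k) * t ^ (2 + k)) - S1) < eps / 2) in Hd.
  unfold minor_fun, Series_from. fold S1.
  set (S2 := Series _) in *.
  apply Rabs_def2 in Hd. apply Rabs_def1; lra.
Qed.

Lemma class_map_0 (h g : C -> C) :
  in_RH0 gamma delta lambda h g -> harmonic_map h g 0%C = 0%C.
Proof.
  intros [[_ [_ [H1 [_ [H2 _]]]]] _]. unfold harmonic_map. rewrite H1, H2.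
  unfold Cplus, Cconj, RtoC; simpl. f_equal; ring.
Qed.

(** A boundary point of modulus below the limit of the growth minorant would be
    approached by images of points of a fixed smaller disk, around which the
    image contains disks of fixed radius. *)
Lemma class_boundary_far (h g : C -> C) (a b : nat -> C) (w : C) :
  in_RH0 gamma delta lambda h g -> has_expansion 1%C a h -> has_expansion 0%C b g ->
  boundary (image_of_disk (harmonic_map h g)) w ->
  minor_fun gamma delta lambda 1 <= Cmod w.
Proof.
  intros Hc Ha Hb Hw. apply Rnot_lt_le. intros Hlt.
  set (M := minor_fun gamma delta lambda 1) in *.
  set (e := (M - Cmod w) / 2). assert (e0 : 0 < e) by (unfold e; lra).
  destruct (minor_fun_left_limit e e0) as [d [Hd Hlim]]. fold M in Hlim.
  set (r0 := 1 - d / 2). assert (Hr0 : 0 < r0 < 1) by (unfold r0; lra).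
  destruct (harmonic_uniformly_open _ _ h g _ r0 (expansion_power_series _ _ _ Ha)
    (expansion_power_series _ _ _ Hb) (jacobian_bound_pos _ _ _ adm)
    (class_jacobian _ _ _ adm h g a b Hc Ha Hb) Hr0) as [eta [eta0 Hopen]].
  assert (P : 0 < Rmin (eta / 2) e) by (apply Rmin_glb_lt; lra).
  destruct (Hw (mkposreal _ P)) as [[u [[z [Dz Ez]] Hu]] [v [Hv Hvw]]]. simpl in Hu, Hvw.
  assert (U1 := Rlt_le_trans _ _ _ Hu (Rmin_l _ _)).
  assert (U2 := Rlt_le_trans _ _ _ Hu (Rmin_r _ _)).
  assert (V1 := Rlt_le_trans _ _ _ Hvw (Rmin_l _ _)).
  assert (Hz : Cmod z <= r0).
  { apply Rnot_lt_le. intros Hz. unfold unit_disk in Dz.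
    assert (G := class_growth _ _ _ adm h g a b Hc Ha Hb z Dz). rewrite Ez in G.
    specialize (Hlim (Cmod z) ltac:(unfold r0 in Hz; lra)).
    apply Rabs_def2 in Hlim.
    assert (T := Cmod_le_of_minus w u). unfold e in *. lra. }
  apply Hv. apply (Hopen z v Hz). rewrite Ez.
  assert (T := Cmod_triangle_3 v w u). rewrite (Cmod_minus_sym w u) in T. lra.
Qed.

Lemma class_dist_ge (h g : C -> C) (a b : nat -> C) :
  in_RH0 gamma delta lambda h g -> has_expansion 1%C a h -> has_expansion 0%C b g ->
  Rbar_le (minor_fun gamma delta lambda 1)
    (dist_to_set (harmonic_map h g 0%C) (boundary (image_of_disk (harmonic_map h g)))).
Proof.
  intros Hc Ha Hb. unfold dist_to_set.
  apply Glb_Rbar_correct. intros x [w [Hw ->]]. simpl.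
  rewrite (class_map_0 _ _ Hc). replace (w - 0)%C with w by ring.
  now apply (class_boundary_far h g a b).
Qed.

End Majorant.

(** * Sharpness: the extremal map *)

(** A mean value inequality from quadratic local estimates: with [n] equal steps
    the total error is [B / n]. *)
Lemma subdivision_lower_bound (phi : R -> R) (A B : R) :
  0 <= B ->
  (forall s t, 0 <= s <= t -> t <= 1 -> A * (t - s) - B * (t - s) ^ 2 <= phi t - phi s) ->
  A <= phi 1 - phi 0.
Proof.
  intros HB H. apply le_epsilon. intros eps He.
  destruct (archimed_cor1 (eps / (B + 1))) as [n [Hn n0]];
    [apply Rdiv_lt_0_compat; lra|].
  assert (Pn : 0 < INR n) by now apply lt_0_INR.
  assert (Ind : forall k, (k <= n)%nat ->
     INR k * (A / INR n - B / INR n ^ 2) <= phi (INR k / INR n) - phi 0).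
  { induction k as [|k IH]; intros Hk.
    - change (INR 0) with 0. replace (0 / INR n) with 0 by (field; lra). lra.
    - assert (K0 := pos_INR k).
      assert (Kn : INR k + 1 <= INR n) by (rewrite <- S_INR; now apply le_INR).
      specialize (IH ltac:(lia)). rewrite S_INR.
      assert (I1 : 0 < / INR n) by now apply Rinv_0_lt_compat.
      assert (I2 : (INR k + 1) / INR n <= 1).
      { apply Rmult_le_reg_r with (INR n); [exact Pn|].
        replace ((INR k + 1) / INR n * INR n) with (INR k + 1) by (field; lra). lra. }
      assert (I3 : (INR k + 1) / INR n - INR k / INR n = / INR n) by (field; lra).
      assert (I4 : 0 <= INR k / INR n) by (apply Rdiv_le_0_compat; lra).
      specialize (H (INR k / INR n) ((INR k + 1) / INR n) ltac:(lra) I2).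
      rewrite I3 in H.
      replace ((INR k + 1) * (A / INR n - B / INR n ^ 2)) with
        (INR k * (A / INR n - B / INR n ^ 2) + (A * / INR n - B * (/ INR n) ^ 2))
        by (field; lra). lra. }
  specialize (Ind n (le_n n)).
  replace (INR n / INR n) with 1 in Ind by (field; lra).
  replace (INR n * (A / INR n - B / INR n ^ 2)) with (A - B * / INR n) in Ind
    by (field; lra).
  assert (B * / INR n <= eps); [|lra].
  apply Rle_trans with (B * (eps / (B + 1))); [apply Rmult_le_compat_l; lra|].
  replace (B * (eps / (B + 1))) with (eps * (B / (B + 1))) by (field; lra).
  rewrite <- (Rmult_1_r eps) at 2. apply Rmult_le_compat_l; [lra|].
  apply Rmult_le_reg_r with (B + 1); [lra|].
  replace (B / (B + 1) * (B + 1)) with B by (field; lra). lra.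
Qed.

(** An analytic function whose derivative has real part at least [m] expands
    distances by the factor [m] at least: integrate along the segment. *)
Lemma analytic_expanding (a : nat -> C) (h : C -> C) (m : R) (w z : C) :
  power_series_on_disk a h ->
  (forall x, unit_disk x -> m <= Re (C_derive h x)) ->
  unit_disk w -> unit_disk z ->
  m * Cmod (z - w)%C <= Cmod (h z - h w)%C.
Proof.
  intros Ha Hm Hw Hz. unfold unit_disk in Hw, Hz.
  destruct (Ceq_dec z w) as [->|Hne].
  { replace (w - w)%C with (RtoC 0) by ring. rewrite Cmod_0.
    generalize (Cmod_ge_0 (h w - h w)%C). lra. }
  set (D := (z - w)%C).
  assert (Dn : D <> 0%C) by (intros E; apply Hne, Ceq_minus; exact E).
  assert (D0 := proj1 (Cmod_gt_0 _) Dn).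
  set (rho := (1 + Rmax (Cmod w) (Cmod z)) / 2).
  assert (Hm1 : Rmax (Cmod w) (Cmod z) < 1) by now apply Rmax_lub_lt.
  assert (w0 := Cmod_ge_0 w).
  assert (L1 := Rmax_l (Cmod w) (Cmod z)). assert (L2 := Rmax_r (Cmod w) (Cmod z)).
  assert (Hr : 0 < rho < 1) by (unfold rho; lra).
  destruct (power_series_taylor a h _ rho Ha (power_series_C_derive _ _ Ha) Hr)
    as [K [K0 HK]].
  assert (Seg : forall s, 0 <= s <= 1 -> Cmod (w + s * D)%C <= rho).
  { intros s Hs. replace (w + s * D)%C with (RtoC (1 - s) * w + s * z)%C
      by (unfold D; rewrite RtoC_minus; ring).
    eapply Rle_trans; [apply Cmod_triangle|].
    rewrite !Cmod_mult, !Cmod_R, !Rabs_pos_eq by lra. unfold rho.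
    assert ((1 - s) * Cmod w <= (1 - s) * Rmax (Cmod w) (Cmod z))
      by (apply Rmult_le_compat_l; lra).
    assert (s * Cmod z <= s * Rmax (Cmod w) (Cmod z))
      by (apply Rmult_le_compat_l; lra). lra. }
  set (phi := fun s : R => Re (h (w + s * D) * Cconj D)%C).
  assert (Q : m * Cmod D ^ 2 <= phi 1 - phi 0).
  { apply (subdivision_lower_bound phi _ (K * Cmod D ^ 3)).
    - apply Rmult_le_pos; [lra|]. apply pow_le. lra.
    - intros s t Hs Ht.
      assert (T := HK (w + s * D)%C (w + t * D)%C (Seg s ltac:(lra)) (Seg t ltac:(lra))).
      replace (w + t * D - (w + s * D))%C with (RtoC (t - s) * D)%C in T
        by (rewrite RtoC_minus; ring).
      set (E := (h (w + t * D) - h (w + s * D)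
                 - C_derive h (w + s * D) * (RtoC (t - s) * D))%C) in T.
      assert (Us : unit_disk (w + s * D)%C).
      { unfold unit_disk. generalize (Seg s ltac:(lra)). lra. }
      specialize (Hm _ Us).
      replace (phi t - phi s) with
        (Re (E * Cconj D)%C + (t - s) * (Re (C_derive h (w + s * D)%C) * Cmod D ^ 2)).
      2:{ unfold phi. rewrite <- re_scal_r, RtoC_pow.
          rewrite <- RtoC_pow, Cmod2_conj, <- re_scal_l.
          unfold E. rewrite RtoC_minus. unfold Re; simpl; ring. }
      assert (T2 : Rabs (Re (E * Cconj D)%C) <= K * (t - s) ^ 2 * Cmod D ^ 3).
      { eapply Rle_trans; [apply re_le_Cmod|]. rewrite Cmod_mult, Cmod_conj.
        rewrite Cmod_mult, Cmod_R, Rabs_pos_eq in T by lra.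
        apply Rmult_le_compat_r with (r := Cmod D) in T; [|lra].
        eapply Rle_trans; [exact T|]. right. ring. }
      apply Rabs_le_between in T2.
      assert (D2 : 0 <= Cmod D ^ 2) by (apply pow_le; lra).
      assert (T3 : m * Cmod D ^ 2 <= Re (C_derive h (w + s * D)%C) * Cmod D ^ 2)
        by now apply Rmult_le_compat_r.
      apply Rmult_le_compat_l with (r := t - s) in T3; [|lra]. lra. }
  assert (Q2 : phi 1 - phi 0 <= Cmod (h z - h w)%C * Cmod D).
  { unfold phi. replace (w + 1 * D)%C with z by (unfold D; ring).
    replace (w + 0 * D)%C with w by ring.
    replace (Re (h z * Cconj D)%C - Re (h w * Cconj D)%C) with
      (Re ((h z - h w) * Cconj D)%C) by (unfold Re; simpl; ring).
    eapply Rle_trans; [apply Rle_abs|]. eapply Rle_trans; [apply re_le_Cmod|].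
    rewrite Cmod_mult, Cmod_conj. lra. }
  apply Rmult_le_reg_r with (Cmod D); [exact D0|].
  replace (m * Cmod D * Cmod D) with (m * Cmod D ^ 2) by ring. lra.
Qed.

Lemma power_series_unique (a : nat -> C) (h k : C -> C) (z : C) :
  power_series_on_disk a h -> power_series_on_disk a k -> unit_disk z -> h z = k z.
Proof.
  intros Hh Hk Hz.
  exact (filterlim_locally_unique (K := C_AbsRing) (V := C_NormedModule)
           _ _ _ (Hh z Hz) (Hk z Hz)).
Qed.

Lemma power_series_analytic (a : nat -> C) (h : C -> C) :
  power_series_on_disk a h -> analytic_on_disk h.
Proof.
  intros Ha z Hz. exists (C_derive h z).
  apply (power_series_is_derive a); auto. now apply power_series_C_derive.
Qed.

Lemma power_series_zero (a : nat -> C) :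
  (forall n, a n = RtoC 0) -> power_series_on_disk a (fun _ => RtoC 0).
Proof.
  intros Ha. apply (power_series_ext (fun n => match n with O => RtoC 0 | S _ => 0%C end)
    a (fun _ => RtoC 0)); [|reflexivity|apply power_series_const].
  intros n. rewrite Ha. now destruct n.
Qed.

Lemma expansion_of_power_series (c1 : C) (a : nat -> C) (h : C -> C) :
  power_series_on_disk (full_coeff c1 a) h -> has_expansion c1 a h.
Proof.
  intros Ha z Hz.
  assert (H := is_series_shift_C _ _ (is_series_shift_C _ _ (Ha z Hz))).
  cbv beta in H. simpl (full_coeff c1 a 0) in H. simpl (full_coeff c1 a 1) in H.
  replace (h z - c1 * z)%C with (h z - 0 * z ^ 0 - c1 * z ^ 1)%C by (simpl; ring).
  exact H.
Qed.

Section Extremal.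

Variables gamma delta lambda : R.
Hypothesis adm : admissible gamma delta lambda.

Let M := minor_fun gamma delta lambda 1.

Definition extremal_coeff (m : nat) : C := RtoC (major_coeff gamma delta lambda m).

Definition major_sum (N : nat) (r : R) : R :=
  Series_from N (fun m => major_coeff gamma delta lambda m * r ^ m).

Lemma ex_series_major_sum (N : nat) (r : R) : (1 <= N)%nat -> Rabs r <= 1 ->
  ex_series (fun k => major_coeff gamma delta lambda (N + k) * r ^ (N + k)).
Proof.
  intros HN Hr.
  apply (ex_series_ext (fun k => r ^ (N + k) * major_coeff gamma delta lambda (N + k))).
  - intros k. apply Rmult_comm.
  - apply ex_series_weighted_major; auto. intros k.
    rewrite <- RPow_abs. apply pow_unit_bound. split; [apply Rabs_pos|exact Hr].
Qed.

Lemma extremal_exists : exists h, power_series_on_disk (full_coeff 1 extremal_coeff) h.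
Proof.
  apply power_series_exists, CV_radius_ge_1. intros r Hr.
  set (B := 2 * (gamma - lambda) / gamma).
  exists (1 + B). intros n.
  assert (B0 : 0 < B) by (destruct adm; apply Rdiv_lt_0_compat; lra).
  assert (P := pow_unit_bound r n ltac:(lra)).
  rewrite Rabs_mult, Rabs_pos_eq by apply Cmod_ge_0. rewrite Rabs_pos_eq by lra.
  assert (Cmod (full_coeff 1 extremal_coeff n) <= 1 + B).
  { destruct n as [|[|n]]; simpl full_coeff.
    - rewrite Cmod_0. lra.
    - rewrite Cmod_1. lra.
    - unfold extremal_coeff. rewrite Cmod_R.
      destruct (major_coeff_bounds _ _ _ adm (S (S n)) ltac:(lia)) as [B1 B2].
      rewrite Rabs_pos_eq by lra. fold B in B2.
      assert (Hn : 1 <= INR (S (S n))) by (apply (le_INR 1); lia).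
      assert (/ INR (S (S n)) ^ 2 <= 1).
      { rewrite <- Rinv_1. apply Rinv_le_contravar; [lra|]. nra. }
      assert (B * / INR (S (S n)) ^ 2 <= B * 1) by (apply Rmult_le_compat_l; lra). lra. }
  generalize (Cmod_ge_0 (full_coeff 1 extremal_coeff n)). nra.
Qed.

Variable h : C -> C.
Hypothesis Hh : power_series_on_disk (full_coeff 1 extremal_coeff) h.

Let zero_map : C -> C := fun _ => RtoC 0.
Let zero_coeff : nat -> C := fun _ => RtoC 0.

Lemma zero_map_series : power_series_on_disk (full_coeff 0 zero_coeff) zero_map.
Proof. apply power_series_zero. now intros [|[|n]]. Qed.

Lemma class_op_zero_map (z : C) : unit_disk z ->
  class_op gamma delta zero_map z = RtoC 0.
Proof.
  intros Hz.
  apply (power_series_unique (fun _ => RtoC 0) _ (fun _ => RtoC 0) z); auto.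
  - apply (power_series_ext
      (fun n => op_coeff gamma delta n * full_coeff 0 zero_coeff (S n))%C _
      (class_op gamma delta zero_map)); [|reflexivity|].
    + intros [|n]; simpl; unfold zero_coeff; ring.
    + apply class_op_power_series, zero_map_series.
  - now apply power_series_zero.
Qed.

(** [class_op] turns the extremal series into a geometric series, whose sum is
    [gamma + 2 (gamma - lambda) z / (1 - z)]. *)
Lemma extremal_in_class : in_RH0 gamma delta lambda h zero_map.
Proof.
  assert (U0 : unit_disk 0%C) by (unfold unit_disk; rewrite Cmod_0; lra).
  destruct adm as [A1 A2 A3].
  split.
  - repeat split.
    + exact (power_series_analytic _ _ Hh).
    + exact (power_series_analytic _ _ zero_map_series).
    + exact (power_series_0 _ _ Hh).
    + rewrite (power_series_0 _ _ (power_series_C_derive _ _ Hh)).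
      unfold deriv_coeff. simpl. ring.
    + rewrite (power_series_0 _ _ (power_series_C_derive _ _ zero_map_series)).
      unfold deriv_coeff. simpl. ring.
  - intros z Hz. rewrite (class_op_zero_map z Hz), Cmod_0.
    unfold unit_disk in Hz. assert (z0 := Cmod_ge_0 z).
    destruct (ex_series_Cmod (fun n => z ^ n)%C (fun n => Cmod z ^ n)) as [G HG].
    + intros n. rewrite Cmod_pow. lra.
    + apply ex_series_geom. rewrite Rabs_pos_eq; lra.
    + assert (RG := Re_inv_1_minus_ge z G Hz (geometric_series_C _ _ HG)).
      assert (E : class_op gamma delta h z
         = (op_coeff gamma delta 0 * full_coeff 1 extremal_coeff 1 * z ^ 0
            + RtoC (2 * (gamma - lambda)) * (G - z ^ 0))%C).
      { apply (filterlim_locally_unique (K := C_AbsRing) (V := C_NormedModule)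
          _ _ _ (class_op_power_series gamma delta _ _ Hh z Hz)).
        assert (S1 := is_series_scal_C (RtoC (2 * (gamma - lambda))) _ _
                        (is_series_shift_C _ _ HG)).
        apply (is_series_unshift_C (fun n => op_coeff gamma delta n
           * full_coeff 1 extremal_coeff (S n) * z ^ n)%C).
        eapply is_series_ext; [|exact S1]. intros n. cbv beta.
        f_equal. simpl full_coeff. unfold extremal_coeff. rewrite <- RtoC_mult.
        f_equal. assert (O := op_coeff_pos gamma delta (S n) ltac:(lra) A3).
        unfold major_coeff. unfold op_coeff in *. field. lra. }
      replace (op_coeff gamma delta 0 * full_coeff 1 extremal_coeff 1 * z ^ 0)%C
        with (RtoC gamma) in E.
      2:{ unfold op_coeff, denom.
          replace (INR 1 ^ 2 * (2 * gamma + (delta - gamma) * (INR 1 - 1)) / 2)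
            with gamma by (simpl; field). simpl. ring. }
      rewrite E.
      replace (Re (gamma + RtoC (2 * (gamma - lambda)) * (G - z ^ 0) - lambda)%C)
        with ((gamma - lambda) * (2 * Re G - 1)) by (unfold Re; simpl; ring).
      apply Rlt_gt, Rmult_lt_0_compat; [lra|].
      assert (/ 2 < / (1 + Cmod z)); [|lra].
      apply Rinv_lt_contravar; nra.
Qed.

Lemma extremal_expansion : has_expansion 1%C extremal_coeff h.
Proof. apply expansion_of_power_series, Hh. Qed.

Lemma zero_expansion : has_expansion 0%C zero_coeff zero_map.
Proof. apply expansion_of_power_series, zero_map_series. Qed.

Lemma extremal_map_eq (z : C) : harmonic_map h zero_map z = h z.
Proof.
  unfold harmonic_map, zero_map. destruct (h z).
  unfold Cplus, Cconj, RtoC; simpl. f_equal; ring.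
Qed.

Lemma extremal_real (s : R) : Rabs s < 1 -> h s = RtoC (s + major_sum 2 s).
Proof.
  intros Hs.
  assert (Hd : unit_disk s) by (unfold unit_disk; now rewrite Cmod_R).
  assert (S1 := Series_correct _ (ex_series_major_sum 2 s ltac:(lia) ltac:(lra))).
  assert (E : (h s - 1 * s)%C = RtoC (major_sum 2 s)).
  { apply (filterlim_locally_unique (K := C_AbsRing) (V := C_NormedModule)
      _ _ _ (extremal_expansion s Hd)).
    apply is_series_ReIm.
    - refine (is_series_eq _ _ _ _ S1 _ _); [|reflexivity].
      intros k. unfold extremal_coeff. rewrite <- RtoC_pow, <- RtoC_mult. reflexivity.
    - refine (is_series_eq _ _ _ _ (is_series_single 0 0) _ _); [|reflexivity].
      intros k. unfold extremal_coeff. rewrite <- RtoC_pow, <- RtoC_mult.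
      now destruct k. }
  rewrite RtoC_plus, <- E. ring.
Qed.

Lemma extremal_negative (t : R) : 0 <= t < 1 ->
  h (- t)%R = RtoC (- minor_fun gamma delta lambda t).
Proof.
  intros Ht. rewrite extremal_real by (rewrite Rabs_Ropp, Rabs_pos_eq; lra).
  f_equal. unfold major_sum, minor_fun, Series_from.
  rewrite (Series_ext _ (fun k => - ((-1) ^ (2 + k - 1)
    * major_coeff gamma delta lambda (2 + k) * t ^ (2 + k)))).
  - rewrite Series_opp. ring.
  - intros k. replace (- t) with (-1 * t) by ring. rewrite Rpow_mult_distr.
    replace (2 + k - 1)%nat with (S k) by lia. simpl. ring.
Qed.

(** If [h z] were the limit of [h (- t)] as [t] tends to 1, the expansion of
    distances would force [- t] to tend to [z], which lies inside the disk. *)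
Lemma extremal_omits : ~ image_of_disk (harmonic_map h zero_map) (RtoC (- M)).
Proof.
  intros [z [Hz Ez]]. rewrite extremal_map_eq in Ez.
  set (m := jacobian_bound gamma lambda).
  assert (m0 : 0 < m) by apply (jacobian_bound_pos _ _ _ adm).
  assert (Hexp : forall w, unit_disk w -> m * Cmod (z - w)%C <= Cmod (h z - h w)%C).
  { intros w Hw. apply (analytic_expanding _ h m w z Hh); auto. intros x Hx.
    assert (J := class_jacobian _ _ _ adm h zero_map _ _ extremal_in_class
                   extremal_expansion zero_expansion x Hx).
    fold m in J. generalize (Cmod_ge_0 (C_derive zero_map x)). lra. }
  unfold unit_disk in Hz.
  assert (e0 : 0 < m * ((1 - Cmod z) / 2)) by (apply Rmult_lt_0_compat; lra).
  destruct (minor_fun_left_limit _ _ _ adm _ e0) as [d [Hd Hlim]].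
  set (s := Rmin d (1 - Cmod z) / 2).
  assert (z0 := Cmod_ge_0 z).
  assert (Hs : 0 < s /\ s < d /\ s <= (1 - Cmod z) / 2).
  { assert (0 < Rmin d (1 - Cmod z)) by (apply Rmin_glb_lt; lra).
    generalize (Rmin_l d (1 - Cmod z)) (Rmin_r d (1 - Cmod z)). unfold s. lra. }
  specialize (Hlim (1 - s) ltac:(lra)).
  assert (Hw : unit_disk (RtoC (- (1 - s)))).
  { unfold unit_disk. rewrite Cmod_R, Rabs_Ropp, Rabs_pos_eq; lra. }
  specialize (Hexp _ Hw). rewrite Ez, extremal_negative in Hexp by lra.
  rewrite <- RtoC_minus, Cmod_R in Hexp.
  replace (- M - - minor_fun gamma delta lambda (1 - s))
    with (minor_fun gamma delta lambda (1 - s) - M) in Hexp by ring.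
  assert (T := Cmod_le_of_minus z (RtoC (- (1 - s)))).
  rewrite Cmod_R, Rabs_Ropp, Rabs_pos_eq, Cmod_minus_sym in T by lra.
  assert (m * ((1 - Cmod z) / 2) <= m * Cmod (z - RtoC (- (1 - s)))%C)
    by (apply Rmult_le_compat_l; lra).
  fold M in Hlim. lra.
Qed.

Lemma extremal_boundary :
  boundary (image_of_disk (harmonic_map h zero_map)) (RtoC (- M)).
Proof.
  intros eps. split.
  - destruct (minor_fun_left_limit _ _ _ adm eps (cond_pos eps)) as [d [Hd Hlim]].
    specialize (Hlim (1 - d / 2) ltac:(lra)).
    exists (h (- (1 - d / 2))%R). split.
    + exists (RtoC (- (1 - d / 2))). split; [|apply extremal_map_eq].
      unfold unit_disk. rewrite Cmod_R, Rabs_Ropp, Rabs_pos_eq; lra.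
    + rewrite extremal_negative, <- RtoC_minus, Cmod_R by lra.
      rewrite Rabs_minus_sym.
      replace (- M - - minor_fun gamma delta lambda (1 - d / 2)) with
        (minor_fun gamma delta lambda (1 - d / 2) - M) by ring. exact Hlim.
  - exists (RtoC (- M)). split; [exact extremal_omits|].
    replace (RtoC (- M) - RtoC (- M))%C with (RtoC 0) by ring.
    rewrite Cmod_0. apply cond_pos.
Qed.

Lemma extremal_dist_le : 0 <= M ->
  Rbar_le (dist_to_set (harmonic_map h zero_map 0%C)
             (boundary (image_of_disk (harmonic_map h zero_map)))) M.
Proof.
  intros HM. unfold dist_to_set.
  apply (Glb_Rbar_correct (fun d => exists w,
    boundary (image_of_disk (harmonic_map h zero_map)) w
    /\ d = Cmod (w - harmonic_map h zero_map 0%C)%C)).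
  exists (RtoC (- M)). split; [exact extremal_boundary|].
  rewrite (class_map_0 _ _ _ _ _ extremal_in_class).
  replace (RtoC (- M) - 0)%C with (RtoC (- M)) by ring.
  rewrite Cmod_R, Rabs_Ropp, Rabs_pos_eq; auto.
Qed.

End Extremal.

(** * The radius equation *)

Section Radius.

Variables (N : nat) (gamma delta lambda : R).
Hypothesis HN : (2 <= N)%nat.
Hypothesis adm : admissible gamma delta lambda.

Let M := minor_fun gamma delta lambda 1.
Let F := bohr_lhs N gamma delta lambda.

Lemma bohr_lhs_eq (r : R) :
  F r = (r + major_sum gamma delta lambda 2 r) ^ 2
        + major_sum gamma delta lambda N r - M.
Proof.
  unfold F, bohr_lhs, M, minor_fun, major_sum, Series_from.
  assert (E : forall L, Series (fun k => 4 * (gamma - lambda) * r ^ (L + k)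
       / denom gamma delta (L + k)) = Series (fun k =>
       major_coeff gamma delta lambda (L + k) * r ^ (L + k))).
  { intros L. apply Series_ext. intros k. unfold major_coeff, Rdiv. ring. }
  rewrite !E.
  rewrite <- Series_scal_l.
  rewrite (Series_ext (fun k => (-1) ^ (2 + k - 1) * major_coeff gamma delta lambda (2 + k)
     * 1 ^ (2 + k)) (fun k => 4 * (gamma - lambda) *
     ((-1) ^ (2 + k - 1) / denom gamma delta (2 + k)))).
  - ring.
  - intros k. rewrite pow1. unfold major_coeff, Rdiv. ring.
Qed.

Lemma major_sum_le (L : nat) (r s : R) : (1 <= L)%nat -> 0 <= r <= s -> s <= 1 ->
  0 <= major_sum gamma delta lambda L r <= major_sum gamma delta lambda L s.
Proof.
  intros HL Hr Hs.
  assert (P : forall k, 0 <= major_coeff gamma delta lambda (L + k) * r ^ (L + k)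
     <= major_coeff gamma delta lambda (L + k) * s ^ (L + k)).
  { intros k. destruct (major_coeff_bounds _ _ _ adm (L + k) ltac:(lia)) as [B _].
    assert (0 <= r ^ (L + k) <= s ^ (L + k)).
    { split; [apply pow_le; lra|apply pow_incr; lra]. }
    split; [apply Rmult_le_pos; lra|apply Rmult_le_compat_l; lra]. }
  assert (Es := ex_series_major_sum _ _ _ adm L s HL ltac:(rewrite Rabs_pos_eq; lra)).
  assert (Er := ex_series_major_sum _ _ _ adm L r HL ltac:(rewrite Rabs_pos_eq; lra)).
  unfold major_sum, Series_from. split.
  - rewrite <- (is_series_unique _ _ (is_series_single 0 0)).
    apply Series_le; [|exact Er]. intros k. specialize (P k). now destruct k.
  - now apply Series_le.
Qed.

Lemma bohr_lhs_increasing (r s : R) : 0 <= r < s -> s <= 1 -> F r < F s.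
Proof.
  intros Hr Hs. rewrite !bohr_lhs_eq.
  assert (H2 := major_sum_le 2 r s ltac:(lia) ltac:(lra) Hs).
  assert (H3 := major_sum_le N r s ltac:(lia) ltac:(lra) Hs).
  assert ((r + major_sum gamma delta lambda 2 r) ^ 2
          < (s + major_sum gamma delta lambda 2 s) ^ 2); [|lra].
  nra.
Qed.

Lemma major_sum_continuous (L : nat) (x : R) : (1 <= L)%nat -> Rabs x < 1 ->
  continuity_pt (major_sum gamma delta lambda L) x.
Proof.
  intros HL Hx. apply continuity_pt_filterlim.
  apply (tannery (locally x) (fun t k => major_coeff gamma delta lambda (L + k) * t ^ (L + k))
    (fun k => major_coeff gamma delta lambda (L + k) * x ^ (L + k))
    (fun k => major_coeff gamma delta lambda (L + k))).
  - intros k.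
    assert (C : continuity_pt (fun t => major_coeff gamma delta lambda (L + k) * t ^ (L + k)) x).
    { apply derivable_continuous_pt.
      apply derivable_pt_mult; [apply derivable_pt_const|apply derivable_pt_pow]. }
    apply continuity_pt_filterlim in C. exact C.
  - assert (P : 0 < 1 - Rabs x) by lra.
    exists (mkposreal _ P). intros t Ht k.
    assert (Ht' : Rabs (t - x) < 1 - Rabs x) by exact Ht.
    assert (T := Rabs_triang_inv t x).
    destruct (major_coeff_bounds _ _ _ adm (L + k) ltac:(lia)) as [B _].
    assert (B2 := pow_unit_bound (Rabs t) (L + k)
                    ltac:(split; [apply Rabs_pos|lra])).
    rewrite Rabs_mult, <- RPow_abs, Rabs_pos_eq by lra. nra.
  - now apply (ex_series_major _ _ _ adm).
Qed.

Lemma bohr_lhs_continuous (x : R) : Rabs x < 1 -> continuity_pt F x.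
Proof.
  intros Hx.
  apply (continuity_pt_ext (fun r => (r + major_sum gamma delta lambda 2 r) ^ 2
        + major_sum gamma delta lambda N r - M)).
  { intros r. symmetry. apply bohr_lhs_eq. }
  assert (C2 := major_sum_continuous 2 x ltac:(lia) Hx).
  assert (C3 := major_sum_continuous N x ltac:(lia) Hx).
  assert (Ci : continuity_pt (fun r => r) x) by apply derivable_continuous_pt, derivable_pt_id.
  assert (C4 := continuity_pt_plus _ _ x Ci C2).
  apply continuity_pt_minus; [|apply continuity_pt_const; now intros ? ?].
  apply continuity_pt_plus; [|exact C3].
  apply (continuity_pt_ext (fun r => (r + major_sum gamma delta lambda 2 r) *
     (r + major_sum gamma delta lambda 2 r))).
  { intros r. simpl. ring. }
  now apply continuity_pt_mult.
Qed.

(** The limit of the minorant is an alternating series with decreasing terms,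
    so it lies between its first partial sums. *)
Lemma minor_limit_between : 0 < M < 1.
Proof.
  set (c := fun k => major_coeff gamma delta lambda (2 + k)).
  assert (cpos : forall k, 0 < c k).
  { intros k. now destruct (major_coeff_bounds _ _ _ adm (2 + k) ltac:(lia)). }
  destruct adm as [A1 A2 A3].
  assert (dpos : forall m, (1 <= m)%nat -> 0 < denom gamma delta m
     /\ denom gamma delta m < denom gamma delta (S m)).
  { intros m Hm. unfold denom. rewrite S_INR.
    assert (P : 1 <= INR m) by (apply (le_INR 1); exact Hm).
    assert (0 <= (delta - gamma) * (INR m - 1)) by (apply Rmult_le_pos; lra).
    assert (0 < INR m ^ 2) by (apply pow_lt; lra).
    split; [apply Rmult_lt_0_compat; lra|].
    apply Rlt_le_trans with
      ((INR m + 1) ^ 2 * (2 * gamma + (delta - gamma) * (INR m - 1))).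
    - apply Rmult_lt_compat_r; [lra|]. simpl. nra.
    - apply Rmult_le_compat_l; [apply pow_le; lra|]. nra. }
  assert (cdec : forall k, c (S k) < c k).
  { intros k. unfold c, major_coeff, Rdiv. apply Rmult_lt_compat_l; [lra|].
    destruct (dpos (2 + k)%nat ltac:(lia)) as [D1 D2].
    replace (2 + S k)%nat with (S (2 + k)) by lia.
    apply Rinv_lt_contravar; [|exact D2]. apply Rmult_lt_0_compat; lra. }
  assert (c0 : c 0%nat < 1).
  { assert (E : denom gamma delta 2 = 4 * (gamma + delta)).
    { unfold denom. replace (INR 2) with 2 by (simpl; ring). ring. }
    unfold c, major_coeff. change (2 + 0)%nat with 2%nat. rewrite E.
    apply Rmult_lt_reg_r with (4 * (gamma + delta)); [lra|].
    unfold Rdiv. rewrite Rmult_assoc, Rinv_l by lra. lra. }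
  assert (Es : ex_series (fun k => (-1) ^ k * c k)).
  { apply ex_series_weighted_major; [constructor; assumption|lia|].
    intros k. rewrite pow_1_abs. lra. }
  assert (EM : M = 1 - Series (fun k => (-1) ^ k * c k)).
  { unfold M, minor_fun, Series_from.
    rewrite (Series_ext _ (fun k => - ((-1) ^ k * c k))).
    - rewrite Series_opp. ring.
    - intros k. rewrite pow1. replace (2 + k - 1)%nat with (S k) by lia.
      unfold c. simpl. ring. }
  set (l := Series (fun k => (-1) ^ k * c k)) in *.
  assert (B : c 0%nat - c 1%nat <= l <= c 0%nat).
  { assert (H := alternated_series_ineq c l 0).
    simpl in H. unfold tg_alt in H. simpl in H.
    assert (sum1 : 1 * c 0%nat + -1 * 1 * c 1%nat <= l <= 1 * c 0%nat); [|lra].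
    apply H.
    - intros k. left. apply cdec.
    - apply is_lim_seq_Reals, ex_series_lim_0.
      apply (ex_series_major gamma delta lambda); [constructor; assumption|lia].
    - apply is_series_Reals. exact (Series_correct _ Es). }
  rewrite EM. specialize (cdec 0%nat). lra.
Qed.

(** At [(1 + M) / 2] the square of the first summand alone exceeds [M]. *)
Lemma bohr_root_exists : exists r, 0 < r < 1 /\ F r = 0.
Proof.
  assert (HM := minor_limit_between).
  set (r1 := (1 + M) / 2). assert (Hr1 : 0 < r1 < 1) by (unfold r1; lra).
  assert (F0 : F 0 < 0).
  { rewrite bohr_lhs_eq.
    assert (Z : forall L, (1 <= L)%nat -> major_sum gamma delta lambda L 0 = 0).
    { intros L HL. unfold major_sum, Series_from.
      rewrite (Series_ext _ (fun k => if Nat.eqb k 0 then 0 else 0)).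
      - apply is_series_unique, is_series_single.
      - intros k. rewrite pow_i by lia. destruct k; simpl; ring. }
    rewrite !Z by lia. lra. }
  assert (F1 : 0 < F r1).
  { rewrite bohr_lhs_eq.
    assert (H2 := major_sum_le 2 r1 r1 ltac:(lia) ltac:(lra) ltac:(lra)).
    assert (H3 := major_sum_le N r1 r1 ltac:(lia) ltac:(lra) ltac:(lra)).
    assert (M < r1 ^ 2) by (unfold r1; nra). nra. }
  destruct (IVT_Rbar_incr F 0 r1 (F 0) (F r1) 0) as [x [X1 [X2 X3]]].
  - apply is_lim_continuity, bohr_lhs_continuous. rewrite Rabs_R0. lra.
  - apply is_lim_continuity, bohr_lhs_continuous. rewrite Rabs_pos_eq; lra.
  - intros x X1 X2. simpl in X1, X2. apply bohr_lhs_continuous. rewrite Rabs_pos_eq; lra.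
  - simpl. lra.
  - simpl. lra.
  - exists x. simpl in X1, X2. split; [lra|exact X3].
Qed.

Lemma class_abs_le (h g : C -> C) (a b : nat -> C) (z : C) :
  in_RH0 gamma delta lambda h g -> has_expansion 1%C a h -> has_expansion 0%C b g ->
  unit_disk z ->
  Cmod (harmonic_map h g z) <= Cmod z + major_sum gamma delta lambda 2 (Cmod z) /\
  Series_from N (fun m => (Cmod (a m) + Cmod (b m)) * Cmod z ^ m)
  <= major_sum gamma delta lambda N (Cmod z).
Proof.
  intros Hc Ha Hb Hz. unfold unit_disk in Hz. assert (z0 := Cmod_ge_0 z).
  assert (B : forall m, (2 <= m)%nat -> Cmod (a m) + Cmod (b m)
              <= major_coeff gamma delta lambda m)
    by exact (class_coeff_bound _ _ _ adm h g a b Hc Ha Hb).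
  assert (Em : forall L, (1 <= L)%nat -> ex_series (fun k =>
       major_coeff gamma delta lambda (L + k) * Cmod z ^ (L + k))).
  { intros L HL. apply (ex_series_major_sum _ _ _ adm); [exact HL|].
    rewrite Rabs_pos_eq; lra. }
  assert (pw : forall k, 0 <= Cmod z ^ k) by (intros k; apply pow_le; lra).
  assert (Dom : forall L (u : nat -> R), (2 <= L)%nat ->
     (forall m, 0 <= u m) -> (forall m, (2 <= m)%nat -> u m <= Cmod (a m) + Cmod (b m)) ->
     forall k, 0 <= u (L + k)%nat * Cmod z ^ (L + k)
               <= major_coeff gamma delta lambda (L + k) * Cmod z ^ (L + k)).
  { intros L u HL U0 U1 k. split; [now apply Rmult_le_pos|].
    apply Rmult_le_compat_r; [apply pw|].
    eapply Rle_trans; [apply U1; lia|apply B; lia]. }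
  assert (a0 : forall m, 0 <= Cmod (a m)) by (intros; apply Cmod_ge_0).
  assert (b0 : forall m, 0 <= Cmod (b m)) by (intros; apply Cmod_ge_0).
  split.
  - assert (D1 := Dom 2%nat (fun m => Cmod (a m)) (le_n 2) a0
       ltac:(intros m _; specialize (b0 m); lra)).
    assert (D2 := Dom 2%nat (fun m => Cmod (b m)) (le_n 2) b0
       ltac:(intros m _; specialize (a0 m); lra)).
    assert (Ex : forall u : nat -> R, (forall k, 0 <= u k
         <= major_coeff gamma delta lambda (2 + k) * Cmod z ^ (2 + k)) -> ex_series u).
    { intros u Hu. apply (ex_series_le (K := R_AbsRing) (V := R_CompleteNormedModule) _
        _ (fun k => eq_ind_r (fun x => x <= _) (proj2 (Hu k))
            (Rabs_pos_eq _ (proj1 (Hu k)))) (Em 2%nat ltac:(lia))). }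
    assert (E1 := Ex _ D1). assert (E2 := Ex _ D2). cbv beta in E1, E2.
    assert (H1 := Cmod_is_series_le _ _ _ _ (Ha z Hz) (fun k => Req_le _ _
       (eq_trans (Cmod_mult _ _) (f_equal _ (Cmod_pow _ _)))) (Series_correct _ E1)).
    assert (H2 := Cmod_is_series_le _ _ _ _ (Hb z Hz) (fun k => Req_le _ _
       (eq_trans (Cmod_mult _ _) (f_equal _ (Cmod_pow _ _)))) (Series_correct _ E2)).
    cbv beta in H1, H2.
    assert (H3 : Series (fun k => Cmod (a (2 + k)%nat) * Cmod z ^ (2 + k))
       + Series (fun k => Cmod (b (2 + k)%nat) * Cmod z ^ (2 + k))
       <= major_sum gamma delta lambda 2 (Cmod z)).
    { rewrite <- Series_plus by assumption. unfold major_sum, Series_from.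
      apply Series_le; [|apply Em; lia]. intros k. rewrite <- Rmult_plus_distr_r.
      apply (Dom 2%nat (fun m => Cmod (a m) + Cmod (b m)) (le_n 2)).
      - intros m. specialize (a0 m). specialize (b0 m). lra.
      - intros m _. lra. }
    replace (harmonic_map h g z) with
      (z + ((h z - 1 * z) + Cconj (g z - 0 * z)))%C.
    2:{ unfold harmonic_map. replace (g z - 0 * z)%C with (g z) by ring. ring. }
    eapply Rle_trans; [apply Cmod_triangle|]. apply Rplus_le_compat_l.
    eapply Rle_trans; [apply Cmod_triangle|]. rewrite Cmod_conj. lra.
  - unfold major_sum, Series_from. apply Series_le; [|apply Em; lia].
    apply (Dom N (fun m => Cmod (a m) + Cmod (b m)) HN).
    + intros m. specialize (a0 m). specialize (b0 m). lra.
    + intros m _. lra.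
Qed.

Lemma bohr_inequality_at_root (r : R) : 0 < r < 1 -> F r = 0 ->
  bohr_inequality_upto N gamma delta lambda r.
Proof.
  intros Hr HF h g a b Hc Ha Hb z Hz Hzr.
  eapply Rbar_le_trans; [|exact (class_dist_ge _ _ _ adm h g a b Hc Ha Hb)].
  simpl Rbar_le. fold M.
  destruct (class_abs_le h g a b z Hc Ha Hb Hz) as [H1 H2].
  assert (z0 := Cmod_ge_0 z).
  assert (S2 := major_sum_le 2 (Cmod z) r ltac:(lia) ltac:(lra) ltac:(lra)).
  assert (S3 := major_sum_le N (Cmod z) r ltac:(lia) ltac:(lra) ltac:(lra)).
  rewrite bohr_lhs_eq in HF.
  assert (f0 := Cmod_ge_0 (harmonic_map h g z)).
  assert (Cmod (harmonic_map h g z) ^ 2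
     <= (r + major_sum gamma delta lambda 2 r) ^ 2).
  { apply pow_incr. lra. }
  lra.
Qed.

Lemma bohr_inequality_fails (r rho : R) : 0 < r < 1 -> F r = 0 -> r < rho ->
  ~ bohr_inequality_upto N gamma delta lambda rho.
Proof.
  intros Hr HF Hrho H.
  set (s := (r + Rmin rho 1) / 2).
  assert (Hs : r < s < 1 /\ s <= rho).
  { assert (r < Rmin rho 1) by (apply Rmin_glb_lt; lra).
    generalize (Rmin_l rho 1) (Rmin_r rho 1). unfold s. lra. }
  destruct (extremal_exists _ _ _ adm) as [h Hh].
  assert (Hd : unit_disk s).
  { unfold unit_disk. rewrite Cmod_R, Rabs_pos_eq; lra. }
  assert (Hle : Cmod s <= rho) by (rewrite Cmod_R, Rabs_pos_eq; lra).
  specialize (H h _ _ _ (extremal_in_class _ _ _ adm h Hh)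
    (extremal_expansion _ _ _ h Hh) zero_expansion s Hd Hle).
  assert (HM := minor_limit_between).
  assert (HD := Rbar_le_trans _ _ _ H
    (extremal_dist_le _ _ _ adm h Hh (Rlt_le _ _ (proj1 HM)))).
  simpl Rbar_le in HD. fold M in HD.
  rewrite extremal_map_eq, (extremal_real _ _ _ adm h Hh) in HD
    by (rewrite Rabs_pos_eq; lra).
  rewrite !Cmod_R, (Rabs_pos_eq s) in HD by lra.
  assert (S2 := major_sum_le 2 s s ltac:(lia) ltac:(lra) ltac:(lra)).
  rewrite (Rabs_pos_eq (s + _)) in HD by lra.
  assert (ES : Series_from N (fun m =>
       (Cmod (extremal_coeff gamma delta lambda m) + Rabs 0) * s ^ m)
     = major_sum gamma delta lambda N s).
  { apply Series_ext. intros k. unfold extremal_coeff. rewrite Rabs_R0, Cmod_R.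
    destruct (major_coeff_bounds _ _ _ adm (N + k) ltac:(lia)) as [B _].
    rewrite Rabs_pos_eq by lra. ring. }
  rewrite ES in HD.
  assert (I := bohr_lhs_increasing r s ltac:(lra) ltac:(lra)).
  rewrite HF, bohr_lhs_eq in I. lra.
Qed.

End Radius.

Theorem theorem4p2 :
  forall (N : nat) (gamma delta lambda : R),
    (2 <= N)%nat ->
    0 <= lambda -> lambda < gamma -> gamma <= delta ->
    exists RN : R,
      unique (fun r => 0 < r < 1 /\ bohr_lhs N gamma delta lambda r = 0) RN /\
      bohr_inequality_upto N gamma delta lambda RN /\
      (forall rho : R, RN < rho ->
         ~ bohr_inequality_upto N gamma delta lambda rho).
Proof.
  intros N gamma delta lambda HN H1 H2 H3.
  assert (adm : admissible gamma delta lambda) by now constructor.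
  destruct (bohr_root_exists N gamma delta lambda HN adm) as [r [Hr HF]].
  exists r. split; [split; [now split|]|split].
  - intros s [Hs Hs']. destruct (Rtotal_order r s) as [L|[E|L]]; [exfalso|exact E|exfalso].
    + generalize (bohr_lhs_increasing N gamma delta lambda HN adm r s). lra.
    + generalize (bohr_lhs_increasing N gamma delta lambda HN adm s r). lra.
  - now apply bohr_inequality_at_root.
  - intros rho Hrho. now apply (bohr_inequality_fails N gamma delta lambda HN adm r).
Qed.
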